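(* Let $G$ be a group with identity $1$, let $R$ be an indecomposable commutative ring with unit and let $\mathscr G$ and $\mathscr G'$ be $G$-graded Hausdorff ample groupoids. Suppose that $\mathscr G_1$ is effective. Then the following are equivalent. (1) There is a graded isomorphism $\varphi\colon \mathscr G\to \mathscr G'$. (2) There is a diagonal-preserving graded isomorphism $\Phi\colon R\mathscr G\to R\mathscr G'$ of $R$-algebras. (3) There is a diagonal-preserving graded isomorphism $\Phi\colon R\mathscr G\to R\mathscr G'$ of rings. (4) There is a graded $R$-algebra isomorphism $\Phi\colon R\mathscr G\to R\mathscr G'$ with $\Phi(D(\mathscr G))\subseteq D(\mathscr G')$. (5) There is a graded ring isomorphism $\Phi\colon R\mathscr G\to R\mathscr G'$ with $\Phi(D(\mathscr G))\subseteq D(\mathscr G')$.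
   Context: A commutative ring $R$ with unit is indecomposable if $0\neq 1$ and $0,1$ are its only idempotents. Groupoids. A groupoid $\mathscr G$ is a small category with all arrows invertible; $\mathscr G^{(0)}$ is the set of objects (identified with the identity arrows), $\mathscr G^{(1)}$ the set of arrows, $\boldsymbol d,\boldsymbol r$ the domain and range maps; $\alpha\beta$ is defined when $\boldsymbol d(\alpha)=\boldsymbol r(\beta)$. A topological groupoid has topologies making all structure maps continuous; it is étale if $\boldsymbol d$ is a local homeomorphism (then all structure maps are, and $\mathscr G^{(0)}$ is open in $\mathscr G^{(1)}$). A Boolean space is a Hausdorff space with a basis of compact open sets. An ample groupoid is an étale groupoid with $\mathscr G^{(0)}$ a Boolean space; it is Hausdorff if $\mathscr G^{(1)}$ is Hausdorff. An isomorphism of topological groupoids is a continuous functor with a continuous inverse. The isotropy bundle is the subgroupoid of all arrows $\gamma$ with $\boldsymbol d(\gamma)=\boldsymbol r(\gamma)$. An étale groupoid is effective if the topological interior of its isotropy bundle consists only of identity arrows. Gradings. A $G$-graded groupoid is a topological groupoid with a continuous functor (cocycle) $c\colon\mathscr G\to G$, $G$ being a discrete one-object groupoid; $\mathscr G_g=c^{-1}(g)$ for $g\in G$. $\mathscr G_1$ is a clopen subgroupoid. A graded isomorphism of $G$-graded groupoids is an isomorphism of topological groupoids commuting with the cocycles. Groupoid algebra. $R\mathscr G$ is the $R$-module of compactly supported locally constant functions $\mathscr G^{(1)}\to R$ with product $fg(\gamma)=\sum_{\boldsymbol d(\alpha)=\boldsymbol d(\gamma)}f(\gamma\alpha^{-1})g(\alpha)$.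 It is $G$-graded, the component $R\mathscr G_g$ consisting of the functions supported on $\mathscr G_g$. The diagonal subalgebra $D(\mathscr G)$ is the set of functions supported on $\mathscr G^{(0)}$. An isomorphism $\Phi\colon R\mathscr G\to R\mathscr G'$ is diagonal-preserving if $\Phi(D(\mathscr G))=D(\mathscr G')$, and graded if $\Phi(R\mathscr G_g)=R\mathscr G'_g$ for all $g\in G$. *)

(* Defs.v *)
From HB Require Import structures.
From mathcomp Require Import all_boot all_order all_algebra.
From mathcomp Require Import all_classical.
From mathcomp Require Import topology.

Set Implicit Arguments.
Unset Strict Implicit.
Unset Printing Implicit Defensive.

Import GRing.Theory.
Local Open Scope classical_set_scope.
Local Open Scope ring_scope.

(* Pz rings may be trivial, so that 0 != 1 is part of the condition. *)
Definition indecomposable (R : comPzRingType) : Prop :=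
  0 != 1 :> R /\ forall e : R, e * e = e -> e = 0 \/ e = 1.

Section Topology.
Variables X Y : topologicalType.

Definition boolean_space : Prop :=
  hausdorff_space X /\ basis [set U : set X | open U /\ compact U].

Definition local_homeomorphism (f : X -> Y) : Prop :=
  forall x, exists U : set X,
    [/\ open U, U x, open (f @` U) &
        exists g : Y -> X,
          [/\ {in U, cancel f g}, {within U, continuous f} &
              {within f @` U, continuous g}]].

Definition locally_constant (T : Type) (f : X -> T) : Prop :=
  forall x, \forall y \near x, f y = f x.

End Topology.

(* [gmul a b] is the composite "a after b". It is only meaningful when
   [gdom a = grng b]; its values elsewhere are junk, left unconstrained by the
   axioms (continuity included) and ignored by functors and convolution.
   Objects have their own space; since [gid] and [gdom] are continuous, [gid]
   embeds it in the space of arrows, with image the identity arrows. *)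
Record topGroupoid := TopGroupoid {
  gobj : topologicalType;
  garr : topologicalType;
  gdom : garr -> gobj;
  grng : garr -> gobj;
  gid  : gobj -> garr;
  ginv : garr -> garr;
  gmul : garr -> garr -> garr;
  gdom_id  : forall x, gdom (gid x) = x;
  grng_id  : forall x, grng (gid x) = x;
  gdom_mul : forall a b, gdom a = grng b -> gdom (gmul a b) = gdom b;
  grng_mul : forall a b, gdom a = grng b -> grng (gmul a b) = grng a;
  gmulA    : forall a b c, gdom a = grng b -> gdom b = grng c ->
    gmul a (gmul b c) = gmul (gmul a b) c;
  gmul1l   : forall a, gmul (gid (grng a)) a = a;
  gmul1r   : forall a, gmul a (gid (gdom a)) = a;
  gdom_inv : forall a, gdom (ginv a) = grng a;
  grng_inv : forall a, grng (ginv a) = gdom a;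
  gmulVl   : forall a, gmul (ginv a) a = gid (gdom a);
  gmulVr   : forall a, gmul a (ginv a) = gid (grng a);
  gdom_cts : continuous gdom;
  grng_cts : continuous grng;
  gid_cts  : continuous gid;
  ginv_cts : continuous ginv;
  gmul_cts : {within [set p : garr * garr | gdom p.1 = grng p.2],
                continuous (fun p => gmul p.1 p.2)}
}.

Arguments gid {t}.

Definition etale (X : topGroupoid) : Prop := local_homeomorphism (@gdom X).

Definition ample (X : topGroupoid) : Prop :=
  etale X /\ boolean_space (gobj X).

Definition hausdorff_groupoid (X : topGroupoid) : Prop :=
  hausdorff_space (garr X).

Definition isotropy (X : topGroupoid) : set (garr X) :=
  [set a | gdom a = grng a].

Definition effective (X : topGroupoid) : Prop :=
  (@isotropy X)° `<=` range gid.

Record cfunctor (X Y : topGroupoid) := CFunctor {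
  fobj : gobj X -> gobj Y;
  farr :> garr X -> garr Y;
  farr_dom : forall a, gdom (farr a) = fobj (gdom a);
  farr_rng : forall a, grng (farr a) = fobj (grng a);
  farr_id  : forall x, farr (gid x) = gid (fobj x);
  farr_mul : forall a b, gdom a = grng b ->
    farr (gmul a b) = gmul (farr a) (farr b);
  fobj_cts : continuous fobj;
  farr_cts : continuous farr
}.

Definition groupoid_isomorphism (X Y : topGroupoid) (phi : cfunctor X Y) :
    Prop :=
  exists psi : cfunctor Y X,
    [/\ cancel (fobj phi) (fobj psi), cancel (fobj psi) (fobj phi),
        cancel phi psi & cancel psi phi].

Record gradedGroupoid (G : groupType) := GradedGroupoid {
  underlying :> topGroupoid;
  cocycle : garr underlying -> G;
  cocycle_id  : forall x, cocycle (gid x) = 1%g;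
  cocycle_mul : forall a b, gdom a = grng b ->
    cocycle (gmul a b) = (cocycle a * cocycle b)%g;
  cocycle_cts : continuous (cocycle : garr underlying -> discrete_topology G)
}.


Section Fiber1.
Variables (G : groupType) (X : gradedGroupoid G).

Definition fiber (g : G) : set (garr X) := [set a | cocycle a = g].

Local Notation F := (fiber 1%g : Type).
Implicit Types a b c : F.

Definition fiber1_id (x : gobj X) : F :=
  exist _ (gid x) (mem_set (cocycle_id x)).

Lemma fiber1E a : cocycle (val a) = 1%g.
Proof. exact: (set_mem (valP a)). Qed.

Lemma fiber1_inv_in a : ginv (val a) \in fiber 1%g.
Proof.
apply/mem_set; rewrite /fiber/=; have := cocycle_mul (gdom_inv (val a)).
by rewrite gmulVl cocycle_id fiber1E Monoid.mulm1.
Qed.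

Lemma fiber1_mul_in a b :
  gdom (val a) = grng (val b) -> gmul (val a) (val b) \in fiber 1%g.
Proof.
move=> ab; apply/mem_set; rewrite /fiber/=.
by rewrite cocycle_mul// !fiber1E Monoid.mulm1.
Qed.

Definition fiber1_inv a : F := exist _ (ginv (val a)) (fiber1_inv_in a).

Definition fiber1_mul a b : F := insubd a (gmul (val a) (val b)).

Lemma val_fiber1_mul a b : gdom (val a) = grng (val b) ->
  val (fiber1_mul a b) = gmul (val a) (val b).
Proof. by move=> /fiber1_mul_in ab; rewrite /fiber1_mul val_insubd ab. Qed.

Lemma fiber1_val_cts : continuous (val : F -> garr X).
Proof. exact: initial_continuous. Qed.

Lemma fiber1_into_cts (T : topologicalType) (f : T -> F) :
  continuous (val \o f) -> continuous f.
Proof. exact: (@continuous_comp_initial _ _ _ (val : F -> garr X)). Qed.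

Lemma fiber1_mul_cts :
  {within [set p : F * F | gdom (val p.1) = grng (val p.2)],
     continuous (fun p => fiber1_mul p.1 p.2)}.
Proof.
apply: fiber1_into_cts; set C := [set p : F * F | _].
pose vv (p : F * F) := (val p.1, val p.2).
apply: (@subspace_eq_continuous _ C _ ((fun p => gmul p.1 p.2) \o vv)).
  by move=> p /set_mem Cp /=; rewrite val_fiber1_mul.
apply/subspace_continuousP => p Cp U /= nU.
have vv_cts : {for p, continuous vv}.
  by apply: cvg_pair; [apply: (cvg_comp _ _ cvg_fst) | apply: (cvg_comp _ _ cvg_snd)];
     exact: fiber1_val_cts.
have /subspace_continuousP/(_ (vv p) Cp U nU) := @gmul_cts X.
by move=> /vv_cts; rewrite /= !near_simpl; apply: filterS => q.
Qed.

(* The arrows of degree 1, with the subspace topology; all objects are kept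
   because identity arrows have degree 1. *)
Program Definition fiber1_groupoid : topGroupoid := {|
  gobj := gobj X;
  garr := Topological.clone F _;
  gdom := fun a => gdom (val a);
  grng := fun a => grng (val a);
  gid := fiber1_id;
  ginv := fiber1_inv;
  gmul := fiber1_mul;
  gmul_cts := fiber1_mul_cts
|}.
Next Obligation. by move=> x; exact: gdom_id. Qed.
Next Obligation. by move=> x; exact: grng_id. Qed.
Next Obligation. by move=> a b ab; rewrite /= val_fiber1_mul// gdom_mul. Qed.
Next Obligation. by move=> a b ab; rewrite /= val_fiber1_mul// grng_mul. Qed.
Next Obligation.
move=> a b c ab bc; apply: val_inj; rewrite !val_fiber1_mul ?gmulA//.
  by rewrite gdom_mul.
by rewrite grng_mul.
Qed.
Next Obligation.
by move=> a; apply: val_inj; rewrite val_fiber1_mul/= ?gdom_id ?gmul1l.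
Qed.
Next Obligation.
by move=> a; apply: val_inj; rewrite val_fiber1_mul/= ?grng_id ?gmul1r.
Qed.
Next Obligation. by move=> a; exact: gdom_inv. Qed.
Next Obligation. by move=> a; exact: grng_inv. Qed.
Next Obligation.
by move=> a; apply: val_inj; rewrite val_fiber1_mul/= ?gdom_inv ?gmulVl.
Qed.
Next Obligation.
by move=> a; apply: val_inj; rewrite val_fiber1_mul/= ?grng_inv ?gmulVr.
Qed.
Next Obligation.
by move=> a; apply: continuous_comp; [exact: fiber1_val_cts|exact: gdom_cts].
Qed.
Next Obligation.
by move=> a; apply: continuous_comp; [exact: fiber1_val_cts|exact: grng_cts].
Qed.
Next Obligation. by apply: fiber1_into_cts; exact: gid_cts. Qed.
Next Obligation.
apply: fiber1_into_cts => a.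
by apply: continuous_comp; [exact: fiber1_val_cts|exact: ginv_cts].
Qed.

End Fiber1.

Arguments fiber [G] X g.

Section GradedIsomorphism.
Variables (G : groupType) (X Y : gradedGroupoid G).

Definition graded_cfunctor (phi : cfunctor X Y) : Prop :=
  forall a, cocycle (phi a) = cocycle a.

End GradedIsomorphism.

Section GroupoidRing.
Variables (R : comPzRingType) (X : topGroupoid).
Implicit Types f g : garr X -> R.

Definition groupoid_ring : set (garr X -> R) :=
  [set f | locally_constant f /\ compact (closure [set a | f a != 0])].

(* When X is Hausdorff and etale and f, g are in the groupoid ring, the sum has
   finitely many nonzero terms. *)
Definition conv f g : garr X -> R :=
  fun c => \sum_(a \in [set a | gdom a = gdom c]) f (gmul c (ginv a)) * g a.

Definition supported_on (A : set (garr X)) : set (garr X -> R) :=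
  [set f | [set a | f a != 0] `<=` A].

Definition diagonal_subalgebra : set (garr X -> R) :=
  groupoid_ring `&` supported_on (range gid).

End GroupoidRing.

Arguments groupoid_ring : clear implicits.
Arguments diagonal_subalgebra : clear implicits.

Definition homogeneous_component (R : comPzRingType) (G : groupType)
    (X : gradedGroupoid G) (g : G) : set (garr X -> R) :=
  groupoid_ring R X `&` supported_on (fiber X g).

Arguments homogeneous_component R [G] X g.

(* A map between groupoid rings is a function on all of garr X -> R of which
   only the restriction to groupoid_ring R X matters. For Hausdorff ample
   groupoids groupoid_ring is closed under conv; it need not have a unit. *)
Section Isomorphisms.
Variables (R : comPzRingType).

Definition ring_isomorphism (X Y : topGroupoid)
    (Phi : (garr X -> R) -> (garr Y -> R)) : Prop :=
  [/\ set_bij (groupoid_ring R X) (groupoid_ring R Y) Phi,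
      {in groupoid_ring R X &, forall f g, Phi (f \+ g) = Phi f \+ Phi g} &
      {in groupoid_ring R X &, forall f g,
         Phi (conv f g) = conv (Phi f) (Phi g)}].

Definition algebra_isomorphism (X Y : topGroupoid)
    (Phi : (garr X -> R) -> (garr Y -> R)) : Prop :=
  ring_isomorphism Phi /\
  forall r, {in groupoid_ring R X, forall f,
    Phi (fun a => r * f a) = (fun b => r * Phi f b)}.

Definition diagonal_preserving (X Y : topGroupoid)
    (Phi : (garr X -> R) -> (garr Y -> R)) : Prop :=
  Phi @` diagonal_subalgebra R X = diagonal_subalgebra R Y.

Definition graded_map (G : groupType) (X Y : gradedGroupoid G)
    (Phi : (garr X -> R) -> (garr Y -> R)) : Prop :=
  forall g, Phi @` homogeneous_component R X g = homogeneous_component R Y g.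

End Isomorphisms.

(* Main.v *)
(** Composition with the inverse of a graded isomorphism of groupoids gives a
    diagonal-preserving graded isomorphism of algebras.  Conversely, let [Phi]
    be a graded ring isomorphism mapping [D(X)] into [D(Y)].  Effectiveness of
    [X_1] makes [D(X)] maximal commutative in degree 1, so [Phi] maps [D(X)]
    onto [D(Y)], and [Y_1] is effective as well.  As [R] is indecomposable, the
    idempotents of the diagonals are the indicators of compact open sets of
    objects, and Stone duality yields a homeomorphism [phi0] of the spaces of
    objects.  By compactness, the pairs (domain, range) of the arrows in the
    support of [Phi f] are the [phi0]-images of those in the support of [f].
    Hence, for a homogeneous compact open bisection [U], parallel arrows in the
    support [V] of [Phi 1_U] differ by isotropy arrows filling an open set of
    degree 1, and effectiveness of [Y_1] forces [V] to be a bisection.  The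
    groupoid isomorphism sends [a] in [U] to the arrow of [V] with domain
    [phi0 (gdom a)]. *)
Require Import Defs.
From HB Require Import structures.
From mathcomp Require Import all_boot all_order all_algebra.
From mathcomp Require Import all_classical.
From mathcomp Require Import topology.

Set Implicit Arguments.
Unset Strict Implicit.
Unset Printing Implicit Defensive.

Import GRing.Theory.
Local Open Scope classical_set_scope.
Local Open Scope ring_scope.

(** The traces of the [F i] on [C] form the base of a proper filter; a cluster point of it in [C]
    lies in each closed [F i]. This produces both the points of Stone duality and the arrows with
    prescribed ends. *)
Lemma compact_directed (T : topologicalType) (I : Type) (D : set I)
    (F : I -> set T) (C : set T) :
  compact C -> D !=set0 ->
  (forall i j, D i -> D j -> exists2 k, D k & F k `<=` F i `&` F j) ->
  (forall i, D i -> closed (F i)) ->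
  (forall i, D i -> C `&` F i !=set0) ->
  exists2 c, C c & forall i, D i -> F i c.
Proof.
move=> Cc [i0 Di0] FI Fcl FC.
pose G := filter_from D (fun i => C `&` F i).
have GF : ProperFilter G.
  apply: filter_from_proper => //; apply: filter_from_filter.
    by exists i0.
  move=> i j Di Dj; have [k Dk kij] := FI _ _ Di Dj; exists k => // x [Cx Fx].
  by have [? ?] := kij _ Fx; split.
have [|c [Cc' cG]] := Cc G GF; first by exists i0 => // x [].
exists c => // i Di; apply: (Fcl i Di) => B nB.
by have [|x [[_ ?] ?]] := cG (C `&` F i) B _ nB; [exists i|exists x].
Qed.

Definition compact_open_set (T : topologicalType) (K : set T) : Prop :=
  open K /\ compact K.

(** * Compact open sets of a Boolean space *)

Section BooleanSpace.
Variables (T : topologicalType).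
Hypothesis boolT : boolean_space T.

Lemma boolean_space_nbhs (O : set T) x : open O -> O x ->
  exists K, [/\ compact_open_set K, K x & K `<=` O].
Proof.
move=> oO Ox; have [_ [_ /(_ x O)]] := boolT; case.
  exact: open_nbhs_nbhs.
by move=> K [coK Kx] KO; exists K.
Qed.

Lemma boolean_space_cover x : exists2 K : set T, compact_open_set K & K x.
Proof. by have [K []] := @boolean_space_nbhs setT x openT I; exists K. Qed.

(** Otherwise Hausdorffness gives a compact open neighbourhood of [x] missing [y]. Equalities
    between objects are proved through this criterion. *)
Lemma boolean_space_separated x y :
  (forall K : set T, compact_open_set K -> K x -> K y) -> x = y.
Proof.
move=> xy; apply: contrapT => /eqP xNy; have [hT _] := boolT.
move: hT; rewrite open_hausdorff => /(_ _ _ xNy).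
move=> [[A B] /= [Ax By] [oA oB /eqP AB]].
have [K [coK Kx KA]] := boolean_space_nbhs oA (set_mem Ax).
have : (A `&` B) y by split; [exact/KA/(xy _ coK Kx)|exact: set_mem].
by rewrite AB.
Qed.

Lemma compact_open_closed (K : set T) : compact_open_set K -> closed K.
Proof. by move=> [_ cK]; apply: compact_closed => //; case: boolT. Qed.

Lemma compact_openI (K L : set T) :
  compact_open_set K -> compact_open_set L -> compact_open_set (K `&` L).
Proof.
move=> [oK cK] coL; split; first by apply: openI => //; case: coL.
by apply: compact_closedI => //; exact: compact_open_closed.
Qed.

Lemma compact_openD (K L : set T) :
  compact_open_set K -> compact_open_set L -> compact_open_set (K `\` L).
Proof.
move=> [oK cK] coL; split.
  by apply: openI => //; apply: closed_openC; exact: compact_open_closed.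
by apply: compact_closedI => //; apply: open_closedC; case: coL.
Qed.

End BooleanSpace.

(** * Stone duality for Boolean spaces *)

Section StoneDuality.
Variables (S T : topologicalType).
Hypotheses (boolS : boolean_space S) (boolT : boolean_space T).
Variable k : set S -> set T.

(** An embedding of generalized Boolean algebras: the whole space need not be compact, so relative
    differences replace complements. Only the values of [k] on compact open sets are constrained. *)
Definition compact_open_embedding : Prop :=
  [/\ forall K, compact_open_set K -> compact_open_set (k K),
      forall K L, compact_open_set K -> compact_open_set L ->
        k (K `&` L) = k K `&` k L,
      forall K L, compact_open_set K -> compact_open_set L ->
        k (K `\` L) = k K `\` k L &
      forall K L, compact_open_set K -> compact_open_set L ->
        k K = k L -> K = L].

(** The images of the compact open neighbourhoods of [x] are closed and directed, and meet the
    compact set [k K0], so they share a point [y]. If [x] is outside [K], then [y] lies in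
    [k (K0 \ K)], hence outside [k K]. *)
Lemma stone_point : compact_open_embedding ->
  forall x, exists y, forall K, compact_open_set K -> K x <-> k K y.
Proof.
move=> [kco kI kD kinj] x.
have [K0 coK0 K0x] := boolean_space_cover boolS x.
have [|||||y _ yK] := @compact_directed T (set S)
    [set K | compact_open_set K /\ K x] k (k K0).
- by have [] := kco _ coK0.
- by exists K0.
- move=> K L [coK Kx] [coL Lx]; exists (K `&` L); last by rewrite kI.
  by split=> //; exact: compact_openI.
- by move=> K [coK _]; apply: compact_open_closed => //; exact: kco.
- move=> K [coK Kx]; rewrite -kI//; apply/set0P/eqP => k0.
  have coI : compact_open_set (K0 `&` K) by exact: compact_openI.
  have coE : compact_open_set (@set0 S).
    by split; [exact: open0|exact: compact0].
  (* The empty set is a difference [A \ A], so its image is empty; injectivity of [k] then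
     applies. *)
  have : K0 `&` K = set0.
    by apply: kinj => //; rewrite -[in RHS](setDv (K0 `&` K)) kD// k0 setDv.
  by move=> /seteqP[/(_ x)/(_ (conj K0x Kx))].
- exists y => K coK; split=> [Kx|kKy]; first exact: yK.
  apply: contrapT => NKx.
  have : k (K0 `\` K) y by apply: yK; split; [exact: compact_openD|].
  by rewrite kD// => -[].
Qed.

End StoneDuality.

(** Points are transported along [k] and along its inverse [l] on compact open sets. The two maps
    are mutually inverse because compact open sets separate points. *)
Lemma stone_duality (S T : topologicalType) (k : set S -> set T) :
  boolean_space S -> boolean_space T -> compact_open_embedding k ->
  (forall M, compact_open_set M -> exists2 K, compact_open_set K & k K = M) ->
  exists (f : S -> T) (g : T -> S),
    [/\ cancel f g, cancel g f, continuous f, continuous g &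
        forall K, compact_open_set K -> forall x, K x <-> k K (f x)].
Proof.
move=> boolS boolT kE ksurj; have [kco kI kD kinj] := kE.
(* [choice] yields a total function; the condition on [l M] is vacuous unless [M] is compact
   open. *)
have /choice [l lP] : forall M, exists K,
    compact_open_set M -> compact_open_set K /\ k K = M.
  move=> M; have [/ksurj[K cK kK]|nM] := pselect (compact_open_set M).
    by exists K.
  by exists set0.
have lco M : compact_open_set M -> compact_open_set (l M) by move=> /lP[].
have lK M : compact_open_set M -> k (l M) = M by move=> /lP[].
have lE : compact_open_embedding l.
  split=> //.
  - move=> M N coM coN; have coI := compact_openI boolT coM coN.
    have coL := compact_openI boolS (lco _ coM) (lco _ coN).
    by apply: kinj; rewrite ?lK ?kI ?lK//; exact: lco.
  - move=> M N coM coN; have coI := compact_openD boolT coM coN.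
    have coL := compact_openD boolS (lco _ coM) (lco _ coN).
    by apply: kinj; rewrite ?lK ?kD ?lK//; exact: lco.
  - by move=> M N coM coN lMN; rewrite -(lK M)// lMN lK.
have /choice [f fP] := stone_point boolS boolT kE.
have /choice [g gP] := stone_point boolT boolS lE.
have fg : cancel g f.
  move=> y; apply/esym; apply: (boolean_space_separated boolT) => M coM My.
  by rewrite -(lK M coM); apply/(fP _ _ (lco _ coM))/(gP _ _ coM).
have gf : cancel f g.
  move=> x; apply/esym; apply: (boolean_space_separated boolS) => K coK Kx.
  have -> : K = l (k K).
    have cokK := kco _ coK.
    by apply: kinj; rewrite ?lK//; exact: lco.
  by apply/(gP _ _ (kco _ coK))/(fP _ _ coK).
(* Continuity is tested on compact open sets: the preimage of [M] under [f] is [l M], and that of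
   [K] under [g] is [k K]. *)
exists f, g; split=> // [x O|y O|K coK x]; [| |exact: fP];
  rewrite /= nbhsE => -[B [oB By] BO].
- have [M [coM My MB]] := boolean_space_nbhs boolT oB By.
  have [oL _] := lco _ coM.
  rewrite nbhsE; exists (l M) => [|z lz].
    by split=> //; apply/(fP _ _ (lco _ coM)); rewrite lK.
  by apply/BO/MB; rewrite -(lK M)//; apply/(fP _ _ (lco _ coM)).
- have [K [coK Kg KB]] := boolean_space_nbhs boolS oB By.
  have [oL _] := kco _ coK.
  rewrite nbhsE; exists (k K) => [|z kz].
    by split=> //; rewrite -(fg y); apply/(fP _ _ coK).
  by apply/BO/KB; apply/(fP _ _ coK); rewrite fg.
Qed.

Arguments gdom {t}.
Arguments grng {t}.
Arguments ginv {t}.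

(** * Cancellation laws in groupoids *)

Section GroupoidAlgebraicLaws.
Variable X : topGroupoid.
Implicit Types a b c : garr X.

Lemma gmulK a b : gdom a = grng b -> gmul (gmul a b) (ginv b) = a.
Proof.
by move=> ab; rewrite -gmulA ?grng_inv// gmulVr -ab gmul1r.
Qed.

Lemma gmulVK a b : gdom a = gdom b -> gmul (gmul a (ginv b)) b = a.
Proof.
by move=> ab; rewrite -gmulA ?grng_inv ?gdom_inv// gmulVl -ab gmul1r.
Qed.

Lemma gmulKV a b : grng a = grng b -> gmul a (gmul (ginv a) b) = b.
Proof. by move=> ab; rewrite gmulA ?grng_inv ?gdom_inv// gmulVr ab gmul1l. Qed.

Lemma gid_inj : injective (@gid X).
Proof. exact: can_inj (@gdom_id X). Qed.

Lemma range_gid a : range gid a -> a = gid (gdom a).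
Proof. by move=> [x _ <-]; rewrite gdom_id. Qed.

Lemma gid_eq a b : gdom a = grng b -> range gid (gmul a b) -> a = ginv b.
Proof.
move=> ab /range_gid abE.
by rewrite -(gmulK ab) abE gdom_mul// -grng_inv gmul1l.
Qed.

Lemma ginvK a : ginv (ginv a) = a.
Proof.
apply/esym/gid_eq; first by rewrite grng_inv.
by rewrite gmulVr; exists (grng a).
Qed.

Lemma gmulV_eq a b : gdom a = gdom b -> range gid (gmul a (ginv b)) -> a = b.
Proof. by move=> ab /gid_eq; rewrite grng_inv ginvK; exact. Qed.

End GroupoidAlgebraicLaws.

(** * Topology of ample groupoids *)

Lemma open_preimage (S T : topologicalType) (f : S -> T) (B : set T) :
  continuous f -> open B -> open (f @^-1` B).
Proof. by move=> /continuousP; exact. Qed.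

Lemma open_nearP (T : topologicalType) (A : set T) :
  (forall x, A x -> nbhs x A) -> open A.
Proof. by move=> nA; rewrite openE => x /nA. Qed.

Definition compact_open_bisection (X : topGroupoid) (U : set (garr X)) : Prop :=
  [/\ open U, compact U, set_inj U gdom & set_inj U grng].

Section AmpleTopology.
Variable X : topGroupoid.
Hypothesis ampleX : ample X.
Implicit Types (A O U : set (garr X)) (K L : set (gobj X)).

(** As the image of [U] under [gdom] is open, continuity of the local inverse in the subspace
    topology is continuity in the ambient space. *)
Lemma etale_section (a : garr X) :
  exists (U : set (garr X)) (g : gobj X -> garr X),
  [/\ open U, U a, open (gdom @` U), forall b, U b -> g (gdom b) = b &
      forall b, U b -> {for gdom b, continuous g}].
Proof.
have [U [oU Ua odU [g [gK _ gcts]]]] := ampleX.1 a.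
exists U, g; split=> // [b Ub|b Ub]; first by apply: gK; exact: mem_set.
move: gcts; rewrite continuous_open_subspace//; apply.
by apply: mem_set; exists b.
Qed.

Lemma gdom_open A : open A -> open (gdom @` A).
Proof.
move=> oA; apply: open_nearP => _ [a Aa <-].
have [U [g [oU Ua odU gK gcts]]] := etale_section a.
have : nbhs (gdom a) (g @^-1` A).
  by apply: gcts => //; rewrite gK//; exact: open_nbhs_nbhs.
have : nbhs (gdom a) (gdom @` U).
  by apply: open_nbhs_nbhs; split=> //; exists a.
by apply: filterS2 => _ [b Ub <-] /=; rewrite gK// => Ab; exists b.
Qed.

Lemma ginv_image A : ginv @` A = ginv @^-1` A.
Proof.
apply/seteqP; split=> [_ [a Aa <-]|a Aa] /=; first by rewrite ginvK.
by exists (ginv a); rewrite ?ginvK.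
Qed.

Lemma ginv_open A : open A -> open (ginv @` A).
Proof. by rewrite ginv_image; exact/open_preimage/ginv_cts. Qed.

Lemma grng_open A : open A -> open (grng @` A).
Proof.
have -> : @grng X = gdom \o ginv by apply/funext => a /=; rewrite gdom_inv.
by move=> /ginv_open/gdom_open; rewrite image_comp.
Qed.

(** Near [gid x], both [a] and [gid (gdom a)] lie in a set on which [gdom] is injective; having the
    same domain, they coincide. *)
Lemma open_range_gid : open (range (@gid X)).
Proof.
apply: open_nearP => _ [x _ <-].
have [U [g [oU Ua odU gK gcts]]] := etale_section (gid x).
have : nbhs (gid x) (@gdom X @^-1` (gid @^-1` U)).
  by apply: gdom_cts; apply: gid_cts; rewrite gdom_id; exact: open_nbhs_nbhs.
have : nbhs (gid x) U by exact: open_nbhs_nbhs.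
apply: filterS2 => a Ua' Uda; exists (gdom a) => //.
by rewrite -[LHS](gK _ Uda) gdom_id gK.
Qed.

Lemma compact_open_gid K : compact_open_set K -> compact_open_set (gid @` K).
Proof.
move=> [oK cK]; split; last first.
  by apply: continuous_compact => //; exact/continuous_subspaceT/gid_cts.
have -> : gid @` K = range gid `&` gdom @^-1` K.
  apply/seteqP; split=> [_ [x Kx <-]|_ [[x _ <-]] /=].
    by split; [exists x|rewrite /= gdom_id].
  by rewrite gdom_id => Kx; exists x.
apply: openI; first exact: open_range_gid.
exact: open_preimage (@gdom_cts X) oK.
Qed.

Lemma compact_open_gdom U : compact_open_set U -> compact_open_set (gdom @` U).
Proof.
move=> [oU cU]; split; first exact: gdom_open.
by apply: continuous_compact => //; exact/continuous_subspaceT/gdom_cts.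
Qed.

Lemma compact_open_grng U : compact_open_set U -> compact_open_set (grng @` U).
Proof.
move=> [oU cU]; split; first exact: grng_open.
by apply: continuous_compact => //; exact/continuous_subspaceT/grng_cts.
Qed.

(** On [W] the domain map is injective, and so is the range map, being the domain map after
    inversion. A section over a compact open [K] inside the domains of [W] has the required
    image. *)
Lemma exists_compact_open_bisection O (a : garr X) : open O -> O a ->
  exists U, [/\ compact_open_bisection U, U a & U `<=` O].
Proof.
move=> oO Oa; have [U [g [oU Ua odU gK gcts]]] := etale_section a.
have [V [h [oV Va odV hK hcts]]] := etale_section (ginv a).
pose W := O `&` U `&` ginv @^-1` V.
have oW : open W.
  apply: openI; first exact: openI.
  exact: open_preimage (@ginv_cts X) oV.
have [|K [coK Kda KW]] :=
    boolean_space_nbhs ampleX.2 (gdom_open oW) (_ : (gdom @` W) (gdom a)).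
  by exists a.
have gW y : K y -> W (g y).
  by move=> /KW[b [[Ob Ub] Vb] <-]; rewrite gK.
have domg y : K y -> gdom (g y) = y.
  by move=> /KW[b [[Ob Ub] Vb] <-]; rewrite gK.
exists (g @` K); split; last first.
- by move=> _ [y /gW[[]] ? ? ? <-].
- by exists (gdom a); rewrite ?gK.
split.
- have -> : g @` K = W `&` gdom @^-1` K.
    apply/seteqP; split=> [_ [y Ky <-]|b [Wb Kdb]] /=.
      by split; [exact: gW|rewrite domg].
    by exists (gdom b) => //; rewrite gK//; case: Wb => -[].
  apply: openI => //; by apply: open_preimage (@gdom_cts X) _; case: coK.
- apply: continuous_compact; last by case: coK.
  apply: continuous_in_subspaceT => y /set_mem /KW[b [[_ Ub] _] <-].
  exact: gcts.
- by move=> _ _ /set_mem[y Ky <-] /set_mem[z Kz <-]; rewrite !domg// => ->.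
- move=> b c /set_mem[y Ky <-] /set_mem[z Kz <-] yz.
  have [[_ _] Vy] := gW _ Ky; have [[_ _] Vz] := gW _ Kz.
  by rewrite -(ginvK (g y)) -(ginvK (g z)) -(hK _ Vy) -(hK _ Vz) !gdom_inv yz.
Qed.

End AmpleTopology.

(** * A criterion for isomorphisms of topological groupoids *)

Section Functors.
Variables X Y : topGroupoid.

Lemma cfunctor_inv (phi : cfunctor X Y) (a : garr X) :
  phi (ginv a) = ginv (phi a).
Proof.
apply: gid_eq; first by rewrite farr_dom farr_rng gdom_inv.
rewrite -farr_mul ?gdom_inv// gmulVl farr_id.
by eexists.
Qed.

(** The functor laws of the inverse follow by injectivity of [phi]; its continuity on arrows is the
    openness of [phi]. *)
Lemma groupoid_isomorphism_open (phi : cfunctor X Y)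
    (psi0 : gobj Y -> gobj X) :
  cancel (fobj phi) psi0 -> cancel psi0 (fobj phi) -> continuous psi0 ->
  injective phi -> (forall b, exists a, phi a = b) ->
  (forall A : set (garr X), open A -> open (phi @` A)) ->
  groupoid_isomorphism phi.
Proof.
move=> phi0K psi0K psi0_cts phi_inj /choice[psi psiK] phi_open.
have phiK : cancel phi psi by move=> a; apply: phi_inj; rewrite psiK.
have psi_dom b : gdom (psi b) = psi0 (gdom b).
  by apply: (can_inj phi0K); rewrite -farr_dom psiK psi0K.
have psi_rng b : grng (psi b) = psi0 (grng b).
  by apply: (can_inj phi0K); rewrite -farr_rng psiK psi0K.
have psi_id y : psi (gid y) = gid (psi0 y).
  by apply: phi_inj; rewrite psiK farr_id psi0K.
have psi_mul b c : gdom b = grng c -> psi (gmul b c) = gmul (psi b) (psi c).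
  move=> bc; apply: phi_inj; rewrite psiK farr_mul ?psiK//.
  by rewrite psi_dom psi_rng bc.
have psi_cts : continuous psi.
  apply/continuousP => A oA; rewrite (_ : psi @^-1` A = phi @` A).
    exact: phi_open.
  apply/seteqP; split=> [b Ab|_ [a Aa <-]]; last by rewrite /= phiK.
  by exists (psi b).
by exists (CFunctor psi_dom psi_rng psi_id psi_mul psi0_cts psi_cts).
Qed.

End Functors.

(** * Indicators and locally constant functions *)

Section Functions.
Variables (R : comPzRingType) (T : topologicalType).
Implicit Types (f h : T -> R) (A : set T).

Definition ind A : T -> R := fun x => (x \in A)%:R.

Definition supp f : set T := [set x | f x != 0].

Lemma indT A x : A x -> ind A x = 1.
Proof. by move=> Ax; rewrite /ind mem_set. Qed.

Lemma indF A x : ~ A x -> ind A x = 0.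
Proof. by move=> Ax; rewrite /ind memNset. Qed.

Lemma ind_neq0 A x : ind A x != 0 -> A x.
Proof. by apply: contra_neqP; exact: indF. Qed.

Lemma mul_ind_neq0 A x (r : R) : r * ind A x != 0 -> r != 0 /\ A x.
Proof.
move=> rA; split; last first.
  by apply: ind_neq0; apply: contra_neq rA => ->; rewrite mulr0.
by apply: contra_neq rA => ->; rewrite mul0r.
Qed.

Lemma locally_constant_preimage f (P : set R) :
  locally_constant f -> open (f @^-1` P).
Proof.
by move=> fc; apply: open_nearP => x Px; apply: filterS (fc x) => y /= ->.
Qed.

Lemma supp_open f : locally_constant f -> open (supp f).
Proof. exact: (@locally_constant_preimage f [set r | r != 0]). Qed.

Lemma supp_closed f : locally_constant f -> closed (supp f).
Proof.
move=> fc; rewrite -[supp f]setCK; apply: open_closedC.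
exact: (@locally_constant_preimage f (~` [set r | r != 0])).
Qed.

Lemma locally_constant_ind A : open A -> closed A -> locally_constant (ind A).
Proof.
move=> oA cA x; have [Ax|nAx] := pselect (A x).
  have : nbhs x A by exact: open_nbhs_nbhs.
  by apply: filterS => y Ay; rewrite !indT.
have : nbhs x (~` A) by apply: open_nbhs_nbhs; split=> //; exact: closed_openC.
by apply: filterS => y nAy; rewrite !indF.
Qed.

Lemma locally_constant_mul f h : locally_constant f -> locally_constant h ->
  locally_constant (fun x => f x * h x).
Proof. by move=> fc hc x; apply: filterS2 (fc x) (hc x) => y -> ->. Qed.

End Functions.

Lemma locally_constant_comp (S T : topologicalType) (U : Type) (f : T -> U)
    (h : S -> T) :
  continuous h -> locally_constant f -> locally_constant (f \o h).
Proof. by move=> hc fc x; exact: hc (fc (h x)). Qed.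

(** * The groupoid ring and convolution with diagonal elements *)

Section Convolution.
Variables (R : comPzRingType) (X : topGroupoid).
Implicit Types (f g h : garr X -> R) (K : set (gobj X)) (U : set (garr X)).

(** The support of a locally constant function is clopen, hence equal to its closure. *)
Lemma groupoid_ringP f :
  groupoid_ring R X f <-> locally_constant f /\ compact (supp f).
Proof.
split=> -[fc fk]; split=> //.
  by apply: subclosed_compact fk _; [exact: supp_closed|exact: subset_closure].
by rewrite -(closure_id _).1//; exact: supp_closed.
Qed.

Lemma groupoid_ring_locally_constant f :
  groupoid_ring R X f -> locally_constant f.
Proof. by case. Qed.

(** Convolution with a diagonal element is pointwise multiplication by a locally constant function
    of the domain or range, so this gives membership of such products. *)
Lemma groupoid_ring_mul f h : groupoid_ring R X f -> locally_constant h ->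
  groupoid_ring R X (fun a => f a * h a).
Proof.
move=> /groupoid_ringP[fc fk] hc; have fhc := locally_constant_mul fc hc.
apply/groupoid_ringP; split=> //; apply: subclosed_compact fk _.
  exact: supp_closed.
by move=> a /=; apply: contra_neq => ->; rewrite mul0r.
Qed.

Lemma groupoid_ring_ind U : hausdorff_groupoid X -> compact_open_set U ->
  groupoid_ring R X (ind R U).
Proof.
move=> hX [oU cU]; have clU := compact_closed hX cU.
have lU := locally_constant_ind R oU clU.
apply/groupoid_ringP; split=> //; apply: subclosed_compact cU _.
  exact: supp_closed.
by move=> a /ind_neq0.
Qed.

Lemma groupoid_ring0 : groupoid_ring R X (fun=> 0).
Proof.
apply/groupoid_ringP; split; first by move=> a; exact: nearW.
suff -> : supp (fun=> 0 : R) = @set0 (garr X) by exact: compact0.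
by apply/seteqP; split=> // a; rewrite /supp/= eqxx.
Qed.

Lemma conv_neq0 f g c : conv f g c != 0 ->
  exists a, [/\ gdom a = gdom c, f (gmul c (ginv a)) != 0 & g a != 0].
Proof.
move=> fg0; apply: contrapT => nE; move/eqP: fg0; apply.
apply: fsbig1 => a ac; apply: contrapT => /eqP fga; apply: nE.
exists a; split=> //; first by apply: contra_neq fga => ->; rewrite mul0r.
by apply: contra_neq fga => ->; rewrite mulr0.
Qed.

(** This applies when one factor is diagonal, or when the right factor is the indicator of a
    bisection, which contains at most one arrow of each domain. *)
Lemma conv_single f g c b : gdom b = gdom c ->
  (forall a, gdom a = gdom c -> f (gmul c (ginv a)) != 0 -> g a != 0 ->
    a = b) ->
  conv f g c = f (gmul c (ginv b)) * g b.
Proof.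
move=> bc ab; rewrite /conv.
rewrite -(fsbig_widen [set b]) ?fsbig_set1// => [_ ->//|a [/= ac aNb]].
apply: contrapT => /eqP fga; apply/aNb/ab => //.
  by apply: contra_neq fga => ->; rewrite mul0r.
by apply: contra_neq fga => ->; rewrite mulr0.
Qed.

Lemma conv_diagr f h c : supported_on (range gid) h ->
  conv f h c = f c * h (gid (gdom c)).
Proof.
move=> hD; rewrite (@conv_single _ _ _ (gid (gdom c))) ?gdom_id//.
  by have := @gmulK X c (gid (gdom c)); rewrite gmul1r grng_id => ->.
by move=> a ac _ /hD/range_gid ->; rewrite ac.
Qed.

Lemma conv_diagl h g c : supported_on (range gid) h ->
  conv h g c = h (gid (grng c)) * g c.
Proof.
move=> hD; rewrite (@conv_single _ _ _ c) ?gmulVr//.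
by move=> a ac /hD ca _; apply/esym/gmulV_eq.
Qed.

Definition unit_ind K : garr X -> R := ind R (gid @` K).

Lemma unit_ind_supp K : supported_on (range gid) (unit_ind K).
Proof. by move=> a /ind_neq0[x _ <-]; exists x. Qed.

Lemma unit_ind_gid K x : unit_ind K (gid x) = ind R K x.
Proof.
have [Kx|nKx] := pselect (K x); first by rewrite /unit_ind !indT//; exists x.
by rewrite /unit_ind !indF// => -[y Ky] /gid_inj yx; rewrite yx in Ky.
Qed.

Lemma conv_unit_indr f K c : conv f (unit_ind K) c = f c * ind R K (gdom c).
Proof. by rewrite (conv_diagr _ _ (@unit_ind_supp K)) unit_ind_gid. Qed.

Lemma conv_unit_indl f K c : conv (unit_ind K) f c = ind R K (grng c) * f c.
Proof. by rewrite (conv_diagl _ _ (@unit_ind_supp K)) unit_ind_gid. Qed.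

Section Ample.
Hypotheses (ampleX : ample X) (hX : hausdorff_groupoid X).

Lemma groupoid_ring_unit_ind K :
  compact_open_set K -> groupoid_ring R X (unit_ind K).
Proof.
by move=> coK; apply: groupoid_ring_ind => //; exact: compact_open_gid.
Qed.

Lemma diagonal_unit_ind K :
  compact_open_set K -> diagonal_subalgebra R X (unit_ind K).
Proof.
by move=> coK; split; [exact: groupoid_ring_unit_ind|exact: unit_ind_supp].
Qed.

Lemma locally_constant_ind_compact_open K :
  compact_open_set K -> locally_constant (ind R K).
Proof.
move=> coK; apply: locally_constant_ind; first by case: coK.
by apply: compact_open_closed => //; case: ampleX.
Qed.

Lemma groupoid_ring_conv_unit_indr f K : groupoid_ring R X f ->
  compact_open_set K -> groupoid_ring R X (conv f (unit_ind K)).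
Proof.
move=> fA coK; rewrite (_ : conv _ _ = fun a => f a * ind R K (gdom a)).
  apply: groupoid_ring_mul => //.
  apply: (locally_constant_comp (@gdom_cts X)).
  exact: locally_constant_ind_compact_open.
by apply/funext => a; exact: conv_unit_indr.
Qed.

Lemma groupoid_ring_conv_unit_indl f K : groupoid_ring R X f ->
  compact_open_set K -> groupoid_ring R X (conv (unit_ind K) f).
Proof.
move=> fA coK; rewrite (_ : conv _ _ = fun a => f a * ind R K (grng a)).
  apply: groupoid_ring_mul => //.
  apply: (locally_constant_comp (@grng_cts X)).
  exact: locally_constant_ind_compact_open.
by apply/funext => a; rewrite conv_unit_indl mulrC.
Qed.

End Ample.
End Convolution.

Arguments unit_ind R {X}.

(** * Effectiveness in degree 1 and homogeneous bisections *)

Section Graded.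
Variables (G : groupType) (X : gradedGroupoid G).
Implicit Types (A V : set (garr X)).

Lemma fiber_open (g : G) : open (fiber X g).
Proof.
exact: (@open_preimage _ (discrete_topology G) _ [set g] (@cocycle_cts G X)
  (discrete_open _)).
Qed.

(** Effectiveness of the degree 1 subgroupoid, phrased with open sets of arrows of [X] instead of
    the subtype topology. *)
Definition effective_in_degree1 : Prop :=
  forall A, open A -> A `<=` fiber X 1%g -> A `<=` [set a | gdom a = grng a] ->
    A `<=` range gid.

Lemma effective_fiber1 : effective (fiber1_groupoid X) -> effective_in_degree1.
Proof.
move=> effX A oA A1 Aiso a Aa.
have a1 : a \in fiber X 1%g by apply/mem_set/A1.
pose b : garr (fiber1_groupoid X) := exist _ a a1.
have nA : nbhs b (val @^-1` A).
  exact: (@fiber1_val_cts G X b A (open_nbhs_nbhs (conj oA Aa))).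
have [|x _ xb] := effX b; first by apply: filterS nA => c /Aiso.
by exists x => //; rewrite -[a]/(val b) -xb.
Qed.

(* If [b], [c] in [V] are parallel, [ginv b * c] lies in the open set of
   quotients of parallel elements of [V], which consists of isotropy arrows of
   degree 1. *)
Lemma effective_open_bisection V (g : G) :
  ample X -> effective_in_degree1 -> open V -> V `<=` fiber X g ->
  (forall a b, V a -> V b -> gdom a = gdom b <-> grng a = grng b) ->
  set_inj V gdom.
Proof.
move=> ampleX effX oV Vg Vdr b c /set_mem Vb /set_mem Vc bc.
have rbc : grng b = grng c by apply/Vdr.
pose A := [set a | exists w, [/\ V w, gdom w = grng a & V (gmul w a)]].
have Aq : A (gmul (ginv b) c).
  exists b; split=> //; first by rewrite grng_mul ?grng_inv// gdom_inv.
  by rewrite gmulKV.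
have A1 : A `<=` fiber X 1%g.
  move=> a [w [/Vg wg wa /Vg]]; rewrite /fiber/= cocycle_mul// wg => ga.
  by apply: (mulgI g); rewrite mulg1.
have Aiso : A `<=` [set a | gdom a = grng a].
  move=> a [w [Vw wa Vwa]] /=; rewrite -wa -(gdom_mul wa).
  by apply/(Vdr _ _ Vwa Vw); rewrite grng_mul.
suff oA : open A.
  have /gid_eq := effX _ oA A1 Aiso _ Aq.
  rewrite gdom_inv rbc => /(_ erefl) /(congr1 ginv).
  by rewrite !ginvK.
apply: open_nearP => a [w [Vw wa Vwa]].
have [U [s [oU Uw odU sK scts]]] := etale_section ampleX w.
have sr : s (grng a) = w by rewrite -wa sK.
have scta : {for grng a, continuous s} by rewrite -wa; exact: scts.
have nV : nbhs (s (grng a)) V by rewrite sr; exact: open_nbhs_nbhs.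
have nU : nbhs (grng a) (gdom @` U).
  by apply: open_nbhs_nbhs; split=> //; exists w.
have := @grng_cts X a _ (scta _ nV); have := @grng_cts X a _ nU.
(* Moving [w] along the section [s] keeps it composable with the second factor. Multiplication is
   continuous only on composable pairs, hence the premise inside the neighbourhood. *)
have : nbhs a
    (fun a' => gdom (s (grng a')) = grng a' -> V (gmul (s (grng a')) a')).
  have /subspace_continuousP/(_ (w, a) wa V) := @gmul_cts X.
  move=> /(_ (open_nbhs_nbhs (conj oV Vwa))).
  suff sa : (fun a' => (s (grng a'), a')) @ a --> (s (grng a), a).
    by move: sa; rewrite sr => sa /sa.
  apply: cvg_pair => //=.
  exact: (@continuous_comp _ _ _ grng s a (@grng_cts X a) scta).
apply: filterS3 => a' Vsa' [u Uu ua'] Va'.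
have ds : gdom (s (grng a')) = grng a' by rewrite -ua' sK.
by exists (s (grng a')); split=> //; exact: Vsa'.
Qed.

Definition homogeneous_bisection (U : set (garr X)) : Prop :=
  compact_open_bisection U /\ exists t, U `<=` fiber X t.

Lemma exists_homogeneous_bisection A (a : garr X) : ample X -> open A -> A a ->
  exists U, [/\ homogeneous_bisection U, U a & U `<=` A].
Proof.
move=> ampleX oA Aa.
have [U [bU Ua UA]] := exists_compact_open_bisection ampleX
  (openI oA (fiber_open (cocycle a))) (conj Aa erefl).
exists U; split=> // [|b /UA[]//].
by split=> //; exists (cocycle a) => b /UA[].
Qed.

Lemma homogeneous_bisection_compact_open U :
  homogeneous_bisection U -> compact_open_set U.
Proof. by move=> [[]]. Qed.

Lemma homogeneous_bisection_gdom_inj U a b : homogeneous_bisection U ->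
  U a -> U b -> gdom a = gdom b -> a = b.
Proof. by move=> [[_ _ dinj _] _] Ua Ub; apply: dinj; exact: mem_set. Qed.

Lemma homogeneous_bisection_grng_inj U a b : homogeneous_bisection U ->
  U a -> U b -> grng a = grng b -> a = b.
Proof. by move=> [[_ _ _ rinj] _] Ua Ub; apply: rinj; exact: mem_set. Qed.

Lemma homogeneous_bisectionI U V : hausdorff_groupoid X ->
  homogeneous_bisection U -> homogeneous_bisection V ->
  homogeneous_bisection (U `&` V).
Proof.
move=> hX hU [[oV cV _ _] _]; have [[oU cU _ _] [t Ut]] := hU.
split; last by exists t => a [/Ut].
split; first exact: openI.
- by apply: compact_closedI => //; exact: compact_closed.
- move=> a b /set_mem[Ua _] /set_mem[Ub _].
  exact: homogeneous_bisection_gdom_inj hU Ua Ub.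
- move=> a b /set_mem[Ua _] /set_mem[Ub _].
  exact: homogeneous_bisection_grng_inj hU Ua Ub.
Qed.

Lemma homogeneous_bisection_gid (K : set (gobj X)) : ample X ->
  compact_open_set K -> homogeneous_bisection (gid @` K).
Proof.
move=> ampleX coK; have [oU cU] := compact_open_gid ampleX coK.
split; last by exists 1%g => _ [x _ <-]; exact: cocycle_id.
split=> // a b /set_mem[x _ <-] /set_mem[y _ <-].
  by rewrite !gdom_id => ->.
by rewrite !grng_id => ->.
Qed.

(** Arrows of [U] are determined by their domains. Shrinking a bisection thus becomes multiplication
    by a diagonal indicator, which [Phi] respects when the domain set is compact open. *)
Lemma ind_restrict (R : comPzRingType) U V : homogeneous_bisection U ->
  V `<=` U -> ind R V = conv (ind R U) (unit_ind R (gdom @` V)).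
Proof.
move=> hU VU; apply/funext => a; rewrite conv_unit_indr.
have [Va|nVa] := pselect (V a).
  have dVa : (gdom @` V) (gdom a) by exists a.
  by rewrite (indT _ Va) (indT _ (VU _ Va)) (indT _ dVa) mulr1.
rewrite indF//; apply/esym/eqP; apply: contra_notT nVa.
move=> /mul_ind_neq0[/ind_neq0 Ua [b Vb ba]].
by rewrite (homogeneous_bisection_gdom_inj hU Ua (VU _ Vb)).
Qed.

End Graded.

(** * Idempotents of the diagonal *)

Section DiagonalIdempotents.
Variables (R : comPzRingType) (X : topGroupoid).
Implicit Types (K L : set (gobj X)).

Lemma conv_unit_ind K L :
  conv (unit_ind R K) (unit_ind R L) = unit_ind R (K `&` L).
Proof.
apply/funext => a; rewrite conv_unit_indr.
have [ra|nra] := pselect (range gid a); last first.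
  by rewrite /unit_ind !(@indF _ _ (gid @` _) a) ?mul0r// => -[x _ xa];
     apply: nra; exists x.
case: ra => x _ <-; rewrite !unit_ind_gid gdom_id.
have [Kx|nKx] := pselect (K x); last first.
  by rewrite (indF _ nKx) (@indF _ _ (K `&` L)) ?mul0r// => -[].
have [Lx|nLx] := pselect (L x); last first.
  by rewrite (indF _ nLx) (@indF _ _ (K `&` L)) ?mulr0// => -[].
by rewrite !indT ?mulr1.
Qed.

Lemma unit_ind_inj : 0 != 1 :> R -> injective (@unit_ind R X).
Proof.
move=> R01 K L KL; apply/seteqP; split=> x Kx; apply: (@ind_neq0 R).
  by rewrite -unit_ind_gid -KL unit_ind_gid indT// eq_sym.
by rewrite -unit_ind_gid KL unit_ind_gid indT// eq_sym.
Qed.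

Lemma unit_ind0 : unit_ind R (@set0 (gobj X)) = fun=> 0.
Proof. by apply/funext => a; rewrite /unit_ind image_set0 indF. Qed.

Lemma unit_ind_setID K L :
  unit_ind R (K `\` L) \+ unit_ind R (K `&` L) = unit_ind R K.
Proof.
apply/funext => a /=; have [ra|nra] := pselect (range gid a); last first.
  by rewrite /unit_ind !(@indF _ _ (gid @` _) a) ?addr0// => -[x _ xa];
     apply: nra; exists x.
case: ra => x _ <-; rewrite !unit_ind_gid.
have [Kx|nKx] := pselect (K x); last by rewrite !indF ?addr0// => -[].
have [Lx|nLx] := pselect (L x).
  by rewrite (@indF _ _ (K `\` L)) ?add0r ?indT// => -[].
by rewrite (@indF _ _ (K `&` L)) ?addr0 ?indT// => -[].
Qed.

Lemma diagonal_conv f g c : diagonal_subalgebra R X f ->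
  conv f g c = f (gid (grng c)) * g c.
Proof. by case=> _; exact: conv_diagl. Qed.

(** On identity arrows convolution of diagonal elements is pointwise, so the values of [f] there are
    idempotents of [R], that is 0 or 1. *)
Lemma diagonal_idempotent f : indecomposable R -> ample X ->
  diagonal_subalgebra R X f -> conv f f = f ->
  compact_open_set (gid @^-1` supp f) /\ f = unit_ind R (gid @^-1` supp f).
Proof.
move=> [R01 Ridem] ampleX Df ff; have [/groupoid_ringP[fc fk] fD] := Df.
split.
  split; first exact/open_preimage/supp_open/fc/gid_cts.
  rewrite (_ : _ @^-1` _ = gdom @` supp f).
    by apply: continuous_compact => //; exact/continuous_subspaceT/gdom_cts.
  apply/seteqP; split=> [x fx|_ [a fa <-]]; last first.
    by rewrite /= -(range_gid (fD _ fa)).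
  by exists (gid x) => //; rewrite gdom_id.
apply/funext => a; have [ra|nra] := pselect (range gid a); last first.
  rewrite /unit_ind indF => [|[x _ xa]]; last by apply: nra; exists x.
  by apply/eqP; apply: contra_notT nra => /fD.
case: ra => x _ <-; rewrite unit_ind_gid.
have : f (gid x) * f (gid x) = f (gid x).
  by rewrite -[in RHS]ff (diagonal_conv _ _ Df) grng_id.
move=> /Ridem[fx|fx].
  by rewrite indF// /supp/= fx eqxx.
by rewrite indT// /supp/= fx eq_sym.
Qed.

Lemma groupoid_ring_conv_diagonal f g : groupoid_ring R X f ->
  diagonal_subalgebra R X g -> groupoid_ring R X (conv g f).
Proof.
move=> fA Dg.
rewrite (_ : conv g f = fun a => f a * (g \o (gid \o grng)) a); last first.
  by apply/funext => a; rewrite diagonal_conv// mulrC.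
apply: groupoid_ring_mul => //; apply: locally_constant_comp.
  move=> a; apply: continuous_comp; [exact: grng_cts|exact: gid_cts].
by case: Dg => -[].
Qed.

End DiagonalIdempotents.

(** * From a graded ring isomorphism to a homeomorphism of objects *)

Section Rigidity.
Variables (G : groupType) (R : comPzRingType) (X Y : gradedGroupoid G).
Variable Phi : (garr X -> R) -> (garr Y -> R).
Hypotheses (indR : indecomposable R).
Hypotheses (ampleX : ample X) (hX : hausdorff_groupoid X).
Hypotheses (ampleY : ample Y) (hY : hausdorff_groupoid Y).
Hypotheses (effX : effective_in_degree1 X).
Hypotheses (ringPhi : ring_isomorphism Phi) (gradPhi : graded_map Phi).
Hypothesis diagPhi :
  Phi @` diagonal_subalgebra R X `<=` diagonal_subalgebra R Y.

Implicit Types (f g : garr X -> R) (K L : set (gobj X)).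

Let R01 : 0 != 1 :> R. Proof. by case: indR. Qed.

Lemma Phi_in f : groupoid_ring R X f -> groupoid_ring R Y (Phi f).
Proof. by move=> fA; have [[+ _ _] _ _] := ringPhi; apply. Qed.

Lemma Phi_inj f g : groupoid_ring R X f -> groupoid_ring R X g ->
  Phi f = Phi g -> f = g.
Proof.
by move=> fA gA; have [[_ + _] _ _] := ringPhi; apply; exact: mem_set.
Qed.

Lemma PhiM f g : groupoid_ring R X f -> groupoid_ring R X g ->
  Phi (conv f g) = conv (Phi f) (Phi g).
Proof. by move=> fA gA; have [_ _ M] := ringPhi; apply: M; exact: mem_set. Qed.

Lemma PhiD f g : groupoid_ring R X f -> groupoid_ring R X g ->
  Phi (f \+ g) = Phi f \+ Phi g.
Proof. by move=> fA gA; have [_ D _] := ringPhi; apply: D; exact: mem_set. Qed.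

Lemma Phi0 : Phi (fun=> 0) = fun=> 0.
Proof.
have := PhiD (groupoid_ring0 R X) (groupoid_ring0 R X).
rewrite (_ : _ \+ _ = fun=> 0); last by apply/funext => a /=; rewrite addr0.
move=> P0; apply/funext => b; have := congr1 (fun h => h b) P0.
by move=> /= /eqP; rewrite -subr_eq subrr eq_sym => /eqP.
Qed.

Lemma Phi_homogeneous f t : groupoid_ring R X f -> supp f `<=` fiber X t ->
  supp (Phi f) `<=` fiber Y t.
Proof.
move=> fA fg; have : homogeneous_component R Y t (Phi f).
  by rewrite -gradPhi; exists f.
by case.
Qed.

Lemma Phi_homogeneous_surj h t : groupoid_ring R Y h ->
  supp h `<=` fiber Y t ->
  exists f, [/\ groupoid_ring R X f, supp f `<=` fiber X t & Phi f = h].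
Proof.
move=> hA hg; have : homogeneous_component R Y t h by [].
by rewrite -gradPhi => -[f [fA fg] fh]; exists f.
Qed.

Lemma Phi_diagonal f : diagonal_subalgebra R X f ->
  diagonal_subalgebra R Y (Phi f).
Proof. by move=> fD; apply: diagPhi; exists f. Qed.

Let unitA K : compact_open_set K -> groupoid_ring R X (unit_ind R K).
Proof. exact: groupoid_ring_unit_ind. Qed.

(* Effectiveness makes the diagonal a maximal commutative subalgebra of the
   degree 1 component. *)
Lemma diagonal_of_commute f : groupoid_ring R X f -> supp f `<=` fiber X 1%g ->
  (forall d, diagonal_subalgebra R Y d -> conv (Phi f) d = conv d (Phi f)) ->
  diagonal_subalgebra R X f.
Proof.
move=> fA f1 fcomm; split=> //; apply: effX => //.
  exact/supp_open/groupoid_ring_locally_constant.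
(* Commuting with [unit_ind R K] puts [grng a] in every compact open [K] containing [gdom a]; so the
   support of [f] is isotropy. *)
move=> a fa; apply: (boolean_space_separated ampleX.2) => K coK Kda.
have : conv f (unit_ind R K) = conv (unit_ind R K) f.
  apply: Phi_inj; first exact: groupoid_ring_conv_unit_indr.
    exact: groupoid_ring_conv_unit_indl.
  rewrite !PhiM//; try exact: unitA.
  by apply: fcomm; apply: Phi_diagonal; exact: diagonal_unit_ind.
move=> /(congr1 (fun h => h a)); rewrite conv_unit_indr conv_unit_indl indT//.
by rewrite mulr1 mulrC => fE; move: fa; rewrite /supp/= fE => /mul_ind_neq0[].
Qed.

Lemma range_gid_fiber1 : range (@gid Y) `<=` fiber Y 1%g.
Proof. by move=> _ [y _ <-]; exact: cocycle_id. Qed.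

Lemma diagonal_comm (f g : garr Y -> R) : diagonal_subalgebra R Y f ->
  diagonal_subalgebra R Y g -> conv f g = conv g f.
Proof.
move=> fD gD; apply/funext => b.
rewrite (diagonal_conv _ _ gD) conv_diagr; last by case: gD.
have [fb|fb] := eqVneq (f b) 0; first by rewrite fb mul0r mulr0.
have /range_gid bE : range gid b by case: fD => _; apply.
by rewrite [in LHS]mulrC bE gdom_id grng_id.
Qed.

(** The grading provides a preimage of degree 1. Its image commutes with the commutative diagonal of
    [Y], so the preimage is diagonal: the assumed inclusion of diagonals is an equality. *)
Lemma diagonal_preimage h : diagonal_subalgebra R Y h ->
  exists2 f, diagonal_subalgebra R X f & Phi f = h.
Proof.
move=> hD; have [hA hsupp] := hD.
have [f [fA f1 fh]] :=
  Phi_homogeneous_surj hA (subset_trans hsupp range_gid_fiber1).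
exists f => //; apply: diagonal_of_commute => // d dD.
by rewrite fh; exact: diagonal_comm.
Qed.

Lemma diagonal_reflect f : groupoid_ring R X f ->
  diagonal_subalgebra R Y (Phi f) -> diagonal_subalgebra R X f.
Proof.
move=> fA /diagonal_preimage[g gD gf].
by rewrite -(Phi_inj _ fA gf)//; case: gD.
Qed.

(** The indicator of a bisection of isotropy arrows commutes with the diagonal of [Y]; in degree 1
    its preimage is therefore diagonal, and so is the indicator itself. *)
Lemma effective_target : effective_in_degree1 Y.
Proof.
move=> A oA A1 Aiso b Ab.
have [W [[oW cW _ _] Wb WA]] := exists_compact_open_bisection ampleY oA Ab.
have hA : groupoid_ring R Y (ind R W) by exact: groupoid_ring_ind.
have hW : supp (ind R W) `<=` W by move=> c /ind_neq0.
have [f [fA f1 fh]] := Phi_homogeneous_surj hA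
  (subset_trans hW (subset_trans WA A1)).
suff : diagonal_subalgebra R X f.
  move=> /Phi_diagonal; rewrite fh => -[_]; apply.
  by rewrite /= indT// eq_sym.
apply: diagonal_of_commute => // d dD; rewrite fh; apply/funext => c.
rewrite (diagonal_conv _ _ dD) conv_diagr; last by case: dD.
have [Wc|nWc] := pselect (W c); last by rewrite indF// mul0r mulr0.
by rewrite mulrC (Aiso _ (WA _ Wc)).
Qed.

Definition Phi_units K : set (gobj Y) := gid @^-1` supp (Phi (unit_ind R K)).

Lemma Phi_unitsP K : compact_open_set K ->
  compact_open_set (Phi_units K) /\
  Phi (unit_ind R K) = unit_ind R (Phi_units K).
Proof.
move=> coK; apply: diagonal_idempotent => //.
  by apply: Phi_diagonal; exact: diagonal_unit_ind.
by rewrite -PhiM ?conv_unit_ind ?setIid//; exact: unitA.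
Qed.

Lemma Phi_unit_ind K : compact_open_set K ->
  Phi (unit_ind R K) = unit_ind R (Phi_units K).
Proof. by move=> /Phi_unitsP[]. Qed.

Lemma Phi_unitsI K L : compact_open_set K -> compact_open_set L ->
  Phi_units (K `&` L) = Phi_units K `&` Phi_units L.
Proof.
move=> coK coL; have coI := compact_openI ampleX.2 coK coL.
apply: (unit_ind_inj R01); rewrite -conv_unit_ind -!Phi_unit_ind//.
by rewrite -PhiM ?conv_unit_ind//; exact: unitA.
Qed.

Lemma Phi_units0 : Phi_units set0 = set0.
Proof.
by apply/seteqP; split=> // y; rewrite /Phi_units /supp /= unit_ind0 Phi0 eqxx.
Qed.

Lemma Phi_unitsD K L : compact_open_set K -> compact_open_set L ->
  Phi_units (K `\` L) = Phi_units K `\` Phi_units L.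
Proof.
move=> coK coL; have coD := compact_openD ampleX.2 coK coL.
have coI := compact_openI ampleX.2 coK coL.
apply/seteqP; split=> y => [Dy|[Ky nLy]].
  split.
    have : Phi_units ((K `\` L) `&` K) y by rewrite setIidl//; exact: subDsetl.
    by rewrite Phi_unitsI// => -[].
  move=> Ly; have : Phi_units ((K `\` L) `&` L) y by rewrite Phi_unitsI.
  by rewrite setDE -setIA setICl setI0 Phi_units0.
(* Additivity on the partition of [K] by [L], evaluated at [gid y]: the part in [L] contributes 0,
   so the other one contributes 1. *)
have /(congr1 (fun h => h (gid y))) := PhiD (unitA coD) (unitA coI).
rewrite unit_ind_setID !Phi_unit_ind//= !unit_ind_gid Phi_unitsI// (indT _ Ky).
rewrite (@indF _ _ (_ `&` _)) => [|[//]]; rewrite addr0 => D1.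
by apply: (@ind_neq0 R); rewrite -D1 eq_sym.
Qed.

Lemma Phi_units_embedding : compact_open_embedding Phi_units.
Proof.
split; [by move=> K /Phi_unitsP[]|exact: Phi_unitsI|exact: Phi_unitsD|].
move=> K L coK coL KL; apply: (unit_ind_inj R01); apply: Phi_inj.
- exact: unitA.
- exact: unitA.
- by rewrite !Phi_unit_ind// KL.
Qed.

Lemma Phi_units_surj M : compact_open_set M ->
  exists2 K, compact_open_set K & Phi_units K = M.
Proof.
move=> coM.
have [f fD fM] := diagonal_preimage (diagonal_unit_ind R ampleY hY coM).
have fA : groupoid_ring R X f by case: fD.
have ff : conv f f = f.
  apply: Phi_inj => //; first exact: groupoid_ring_conv_diagonal.
  by rewrite PhiM// fM conv_unit_ind setIid.
have [coK fK] := diagonal_idempotent indR ampleX fD ff.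
eexists; first exact: coK.
by apply: (unit_ind_inj R01); rewrite -Phi_unit_ind// -fK.
Qed.

(** * Supports under [Phi] and the correspondence of arrows *)

Section Arrows.
Variables (phi0 : gobj X -> gobj Y) (psi0 : gobj Y -> gobj X).
Hypotheses (phi0K : cancel phi0 psi0) (psi0K : cancel psi0 phi0).
Hypotheses (phi0_cts : continuous phi0) (psi0_cts : continuous psi0).
Hypothesis Phi_units_phi0 : forall K, compact_open_set K ->
  forall x, K x <-> Phi_units K (phi0 x).

Lemma Phi_conv_unitr f K b : groupoid_ring R X f -> compact_open_set K ->
  Phi (conv f (unit_ind R K)) b = Phi f b * ind R (Phi_units K) (gdom b).
Proof.
by move=> fA coK; rewrite PhiM ?Phi_unit_ind ?conv_unit_indr//; exact: unitA.
Qed.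

Lemma Phi_conv_unitl f K b : groupoid_ring R X f -> compact_open_set K ->
  Phi (conv (unit_ind R K) f) b = ind R (Phi_units K) (grng b) * Phi f b.
Proof.
by move=> fA coK; rewrite PhiM ?Phi_unit_ind ?conv_unit_indl//; exact: unitA.
Qed.

(* [1_L * f * 1_K] vanishes if and only if its image under [Phi] does, and the
   set of end points of a compact support is closed. *)
Lemma Phi_ends f a : groupoid_ring R X f -> f a != 0 ->
  exists b, [/\ Phi f b != 0, gdom b = phi0 (gdom a) & grng b = phi0 (grng a)].
Proof.
move=> fA fa; have /groupoid_ringP[hc hk] := Phi_in fA.
have [K0 coK0 K0a] := boolean_space_cover ampleX.2 (gdom a).
have [L0 coL0 L0a] := boolean_space_cover ampleX.2 (grng a).
have [|||||b hb bP] := @compact_directed _ (set (gobj X) * set (gobj X))%type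
    [set p | [/\ compact_open_set p.1, p.1 (gdom a), compact_open_set p.2 &
                 p.2 (grng a)]]
    (fun p => [set b | Phi_units p.1 (gdom b) /\ Phi_units p.2 (grng b)])
    (supp (Phi f)).
- by [].
- by exists (K0, L0).
- move=> [K L] [K' L'] /= [coK Ka coL La] [coK' K'a coL' L'a].
  exists (K `&` K', L `&` L') => [|b] /=.
    by split=> //; apply: (compact_openI ampleX.2).
  by rewrite !Phi_unitsI// => -[[? ?] [? ?]].
- move=> [K L] /= [coK _ coL _].
  apply: closedI; apply: closed_comp.
  + by move=> b _; exact: gdom_cts.
  + by apply: (compact_open_closed ampleY.2); case: (Phi_unitsP coK).
  + by move=> b _; exact: grng_cts.
  + by apply: (compact_open_closed ampleY.2); case: (Phi_unitsP coL).
- move=> [K L] /= [coK Ka coL La]; apply/set0P/eqP => E0.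
  have fK := groupoid_ring_conv_unit_indr ampleX fA coK.
  have fLK := groupoid_ring_conv_unit_indl ampleX fK coL.
  have : conv (unit_ind R L) (conv f (unit_ind R K)) = fun=> 0.
    apply: Phi_inj => //; first exact: groupoid_ring0.
    rewrite Phi0; apply/funext => b; rewrite Phi_conv_unitl// Phi_conv_unitr//.
    apply/eqP; apply/negP => /negP; rewrite mulrC => /mul_ind_neq0[].
    move=> /mul_ind_neq0[hb Kb] Lb.
    by move/seteqP : E0 => [/(_ b) + _]; apply.
  move=> /(congr1 (fun h => h a)); rewrite conv_unit_indl conv_unit_indr.
  by rewrite !indT// mulr1 mul1r => /eqP; exact/negP.
(* Every compact open set of objects of [Y] is some [Phi_units K], so the conditions collected in
   [bP] determine the ends of [b]. *)
exists b; split=> //; apply/esym; apply: (boolean_space_separated ampleY.2).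
- move=> _ /Phi_units_surj[K coK <-] /(Phi_units_phi0 coK) Ka.
  by have [] := bP (K, L0).
- move=> _ /Phi_units_surj[L coL <-] /(Phi_units_phi0 coL) La.
  by have [] := bP (K0, L).
Qed.

(** The counterpart of [Phi_ends], with the compactness argument in [X]: if no arrow in the support
    of [f] went from [K] to [L], the cut-down function would vanish, yet its image is nonzero at
    [b]. *)
Lemma Phi_ends_preimage f b : groupoid_ring R X f -> Phi f b != 0 ->
  exists a, [/\ f a != 0, gdom b = phi0 (gdom a) & grng b = phi0 (grng a)].
Proof.
move=> fA hb; have /groupoid_ringP[fc fk] := fA.
pose x := psi0 (gdom b); pose y := psi0 (grng b).
have [K0 coK0 K0x] := boolean_space_cover ampleX.2 x.
have [L0 coL0 L0y] := boolean_space_cover ampleX.2 y.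
have [|||||a fa aP] := @compact_directed _ (set (gobj X) * set (gobj X))%type
    [set p | [/\ compact_open_set p.1, p.1 x, compact_open_set p.2 & p.2 y]]
    (fun p => [set a | p.1 (gdom a) /\ p.2 (grng a)]) (supp f).
- by [].
- by exists (K0, L0).
- move=> [K L] [K' L'] /= [coK Ka coL La] [coK' K'a coL' L'a].
  exists (K `&` K', L `&` L') => [|a] /=; last by move=> [[? ?] [? ?]].
  by split=> //; apply: (compact_openI ampleX.2).
- move=> [K L] /= [coK _ coL _].
  apply: closedI; apply: closed_comp.
  + by move=> a _; exact: gdom_cts.
  + exact: (compact_open_closed ampleX.2).
  + by move=> a _; exact: grng_cts.
  + exact: (compact_open_closed ampleX.2).
- move=> [K L] /= [coK Kx coL Ly]; apply/set0P/eqP => E0.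
  have fK := groupoid_ring_conv_unit_indr ampleX fA coK.
  have : conv (unit_ind R L) (conv f (unit_ind R K)) = fun=> 0.
    apply/funext => a; rewrite conv_unit_indl conv_unit_indr.
    apply/eqP; apply/negP => /negP; rewrite mulrC => /mul_ind_neq0[].
    move=> /mul_ind_neq0[fa Ka] La.
    by move/seteqP : E0 => [/(_ a) + _]; apply.
  move=> /(congr1 (fun h => Phi h b)); rewrite Phi0 Phi_conv_unitl//.
  rewrite Phi_conv_unitr// !indT.
  + by rewrite mulr1 mul1r => /eqP; exact/negP.
  + by rewrite -(psi0K (gdom b)); apply/(Phi_units_phi0 coK).
  + by rewrite -(psi0K (grng b)); apply/(Phi_units_phi0 coL).
exists a; split=> //; apply: (can_inj psi0K); rewrite phi0K.
- apply: (boolean_space_separated ampleX.2) => K coK Kx.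
  by have [] := aP (K, L0).
- apply: (boolean_space_separated ampleX.2) => L coL Ly.
  by have [] := aP (K0, L).
Qed.

Let indA U : homogeneous_bisection U -> groupoid_ring R X (ind R U).
Proof.
by move=> /homogeneous_bisection_compact_open; exact: groupoid_ring_ind.
Qed.

Let phi0_inj : injective phi0 := can_inj phi0K.

Lemma Phi_supp_open f : groupoid_ring R X f -> open (supp (Phi f)).
Proof. by move=> /Phi_in/groupoid_ring_locally_constant/supp_open. Qed.

(** The ends of arrows in the support are the [phi0]-images of ends of arrows of [U], so domain and
    range determine each other; effectiveness of the target does the rest. *)
Lemma Phi_ind_bisection U b c : homogeneous_bisection U ->
  Phi (ind R U) b != 0 -> Phi (ind R U) c != 0 -> gdom b = gdom c -> b = c.
Proof.
move=> hU hb hc; have UA := indA hU; have [_ [t Ut]] := hU.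
apply: (effective_open_bisection ampleY effective_target (Phi_supp_open UA)
  (g := t)); [|move=> {}b {}c {}hb {}hc|exact: mem_set|exact: mem_set].
  by apply: Phi_homogeneous => // a /ind_neq0/Ut.
have [a [/ind_neq0 Ua -> ->]] := Phi_ends_preimage UA hb.
have [d [/ind_neq0 Ud -> ->]] := Phi_ends_preimage UA hc.
split=> /phi0_inj ad; congr (phi0 _).
  by rewrite (homogeneous_bisection_gdom_inj hU Ua Ud ad).
by rewrite (homogeneous_bisection_grng_inj hU Ua Ud ad).
Qed.

(** The same argument in the opposite direction, with effectiveness of [X]; it serves surjectivity
    on arrows. *)
Lemma Phi_preimage_bisection f W t a d : groupoid_ring R X f ->
  supp f `<=` fiber X t -> homogeneous_bisection W -> Phi f = ind R W ->
  f a != 0 -> f d != 0 -> gdom a = gdom d -> a = d.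
Proof.
move=> fA ft hW fW fa fd.
have of_ : open (supp f) by exact/supp_open/groupoid_ring_locally_constant.
apply: (effective_open_bisection ampleX effX of_ ft);
  [move=> {}a {}d {}fa {}fd|exact: mem_set|exact: mem_set].
have [b [+ ab ab']] := Phi_ends fA fa; rewrite fW => /ind_neq0 Wb.
have [c [+ dc dc']] := Phi_ends fA fd; rewrite fW => /ind_neq0 Wc.
split=> ad; apply: phi0_inj; rewrite -?ab -?ab' -?dc -?dc'.
  by rewrite (homogeneous_bisection_gdom_inj hW Wb Wc)// ab dc ad.
by rewrite (homogeneous_bisection_grng_inj hW Wb Wc)// ab' dc' ad.
Qed.

(** Quantifying over all homogeneous bisections through [a] makes the relation independent of any
    chosen one. *)
Definition arrow_image a b := gdom b = phi0 (gdom a) /\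
  forall U, homogeneous_bisection U -> U a -> Phi (ind R U) b != 0.

(** One bisection suffices: over the domains of [I] the functions [Phi (ind R U)], [Phi (ind R I)]
    and [Phi (ind R V)] agree, since [Phi] respects restriction. *)
Lemma arrow_image_of U a b : homogeneous_bisection U -> U a ->
  gdom b = phi0 (gdom a) -> Phi (ind R U) b != 0 -> arrow_image a b.
Proof.
move=> hU Ua ba hb; split=> // V hV Va.
pose I := U `&` V.
have hI : homogeneous_bisection I by exact: homogeneous_bisectionI.
have coI := compact_open_gdom ampleX (homogeneous_bisection_compact_open hI).
have bI : Phi_units (gdom @` I) (gdom b).
  by rewrite ba; apply/(Phi_units_phi0 coI); exists a.
have IV W : homogeneous_bisection W -> I `<=` W ->
    Phi (ind R I) b = Phi (ind R W) b.
  move=> hW IW; rewrite [in LHS](ind_restrict _ hW IW) Phi_conv_unitr//.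
    by rewrite indT// mulr1.
  exact: indA.
by rewrite -IV// ?(IV U)// => c [].
Qed.

Lemma arrow_image_exists a : exists b, arrow_image a b.
Proof.
have [U [hU Ua _]] := exists_homogeneous_bisection ampleX openT (I : setT a).
have [||b [hb ba _]] := @Phi_ends (ind R U) a; first exact: indA.
  by rewrite indT// eq_sym.
by exists b; exact: arrow_image_of hU Ua ba hb.
Qed.

(** * The map on arrows is a graded isomorphism *)

Section ArrowMap.
Variable phi : garr X -> garr Y.
Hypothesis phiP : forall a, arrow_image a (phi a).

Let phi_dom a : gdom (phi a) = phi0 (gdom a). Proof. by case: (phiP a). Qed.

Let phi_supp U a : homogeneous_bisection U -> U a -> Phi (ind R U) (phi a) != 0.
Proof. by case: (phiP a) => _; apply. Qed.

Lemma arrow_map_unique U a b : homogeneous_bisection U -> U a ->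
  gdom b = phi0 (gdom a) -> Phi (ind R U) b != 0 -> b = phi a.
Proof.
move=> hU Ua ba hb; apply: (Phi_ind_bisection hU hb); first exact: phi_supp.
by rewrite phi_dom.
Qed.

Lemma arrow_map_rng a : grng (phi a) = phi0 (grng a).
Proof.
have [U [hU Ua _]] := exists_homogeneous_bisection ampleX openT (I : setT a).
have [||b [hb ba rb]] := @Phi_ends (ind R U) a; first exact: indA.
  by rewrite indT// eq_sym.
by rewrite -(arrow_map_unique hU Ua ba hb).
Qed.

Lemma arrow_map_cocycle a : cocycle (phi a) = cocycle a.
Proof.
have [U [hU Ua Ut]] := exists_homogeneous_bisection ampleX
  (fiber_open X (cocycle a)) (erefl (cocycle a)).
apply: (@Phi_homogeneous (ind R U) (cocycle a)); first exact: indA.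
  by move=> b /ind_neq0/Ut.
exact: phi_supp.
Qed.

Lemma arrow_map_id x : phi (gid x) = gid (phi0 x).
Proof.
have [K coK Kx] := boolean_space_cover ampleX.2 x.
have hU := homogeneous_bisection_gid ampleX coK.
apply/esym/(arrow_map_unique hU); first by exists x.
  by rewrite !gdom_id.
rewrite -/(unit_ind R K) Phi_unit_ind// unit_ind_gid indT.
  by rewrite eq_sym.
exact/(Phi_units_phi0 coK).
Qed.

(** For small bisections [U] and [V] around the factors, the product of indicators is the indicator
    of a piece of the bisection [P] around [gmul a b]; multiplicativity of [Phi] transfers this to
    [Y]. *)
Lemma arrow_map_mul a b : gdom a = grng b ->
  phi (gmul a b) = gmul (phi a) (phi b).
Proof.
move=> ab; have [P [hP Pab _]] :=
  exists_homogeneous_bisection ampleX openT (I : setT (gmul a b)).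
have [oP _] := homogeneous_bisection_compact_open hP.
have := @gmul_cts X => /subspace_continuousP/(_ (a, b) ab P).
move=> /(_ (open_nbhs_nbhs (conj oP Pab))).
rewrite /= /within /= => -[[A B] /= [+ +] AB].
rewrite nbhsE => -[A' [oA' A'a] A'A]; rewrite nbhsE => -[B' [oB' B'b] B'B].
have [U [hU Ua UA]] := exists_homogeneous_bisection ampleX oA' A'a.
have coU := homogeneous_bisection_compact_open hU.
have [odU _] := compact_open_gdom ampleX coU.
(* The ranges of [V] are kept among the domains of [U], so that each arrow of [V] has a partner in
   [U]. *)
have [V [hV Vb VB]] := exists_homogeneous_bisection ampleX
  (openI oB' (open_preimage (@grng_cts X) odU))
  (conj B'b (ex_intro2 _ _ a Ua ab)).
have coV := homogeneous_bisection_compact_open hV.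
have coW := compact_open_gdom ampleX coV.
have UVP u v : U u -> V v -> gdom u = grng v -> P (gmul u v).
  move=> Uu Vv uv; apply: (AB (u, v)) => //=; split; first exact/A'A/UA.
  by apply: B'B; case: (VB _ Vv).
(* [U V] is the part of [P] over [gdom @` V]. *)
have UV : conv (ind R P) (unit_ind R (gdom @` V)) = conv (ind R U) (ind R V).
  apply/funext => c; rewrite conv_unit_indr.
  have [[v Vv vc]|nVc] := pselect ((gdom @` V) (gdom c)); last first.
    rewrite (indF _ nVc) mulr0; apply/esym/eqP; apply: contra_notT nVc.
    by move=> /conv_neq0[v [<- _ /ind_neq0 Vv]]; exists v.
  rewrite [X in _ * X]indT ?mulr1; last by exists v.
  rewrite (@conv_single _ _ _ _ _ v)//; last first.
    move=> w wc _ /ind_neq0 Vw.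
    by apply: (homogeneous_bisection_gdom_inj hV) => //; rewrite wc vc.
  rewrite (indT _ Vv) mulr1; congr (_%:R); congr (nat_of_bool _).
  apply/idP/idP => /set_mem cE; apply/mem_set.
    have [_ [u Uu uv]] := VB _ Vv.
    suff -> : c = gmul u v by rewrite gmulK.
    apply: (homogeneous_bisection_gdom_inj hP cE (UVP _ _ Uu Vv uv)).
    by rewrite gdom_mul.
  rewrite -(gmulVK (esym vc)); apply: UVP => //.
  by rewrite gdom_mul ?gdom_inv ?grng_inv.
have bV : Phi_units (gdom @` V) (gdom (phi (gmul a b))).
  by rewrite phi_dom gdom_mul//; apply/(Phi_units_phi0 coW); exists b.
have : Phi (conv (ind R P) (unit_ind R (gdom @` V))) (phi (gmul a b)) != 0.
  rewrite Phi_conv_unitr//; last exact: indA.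
  by rewrite (indT _ bV) mulr1; exact: phi_supp.
(* A nonzero term of the convolution factors [phi (gmul a b)] through the two supports. Comparing
   domains identifies [c] with [phi b], and then the other factor with [phi a]. *)
rewrite UV PhiM; [|exact: indA..] => /conv_neq0[c [cab hU' hV']].
have cE : c = phi b.
  by apply: (arrow_map_unique hV Vb _ hV'); rewrite cab phi_dom gdom_mul.
rewrite -(arrow_map_unique hU Ua _ hU').
  by rewrite -cE gmulVK.
rewrite gdom_mul ?gdom_inv ?grng_inv ?cab//.
by rewrite cE arrow_map_rng ab.
Qed.

(** On [U], [phi] is [phi0] after [gdom], followed by the inverse of the injective open map [gdom]
    on the support of [Phi (ind R U)]. *)
Lemma arrow_map_cts : continuous phi.
Proof.
move=> a O; rewrite nbhsE => -[O' [oO' O'a] O'O].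
have [U [hU Ua _]] := exists_homogeneous_bisection ampleX openT (I : setT a).
have UA := indA hU.
pose V := supp (Phi (ind R U)) `&` O'.
have oV : open V by apply: openI => //; exact: Phi_supp_open.
have odV := gdom_open ampleY oV.
have Va : (gdom @` V) (phi0 (gdom a)).
  by exists (phi a) => //; split=> //; exact: phi_supp.
have nV := phi0_cts (open_nbhs_nbhs (conj odV Va)).
have [oU _] := homogeneous_bisection_compact_open hU.
have nU : nbhs a U by exact: open_nbhs_nbhs.
have := @gdom_cts X a _ nV; move: nU; apply: filterS2 => c Uc [b [hb O'b] bc].
by apply: O'O; rewrite -(arrow_map_unique hU Uc bc hb).
Qed.

(** By [Phi_ends_preimage], each arrow in the open support of [Phi (ind R U)] is the image of an
    arrow of [U]. *)
Lemma arrow_map_open (A : set (garr X)) : open A -> open (phi @` A).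
Proof.
move=> oA; apply: open_nearP => _ [a Aa <-].
have [U [hU Ua UA]] := exists_homogeneous_bisection ampleX oA Aa.
have : nbhs (phi a) (supp (Phi (ind R U))).
  apply: open_nbhs_nbhs; split; last exact: phi_supp.
  by apply: Phi_supp_open; exact: indA.
apply: filterS => b hb.
have [c [/ind_neq0 Uc bc _]] := Phi_ends_preimage (indA hU) hb.
by exists c; [exact: UA|rewrite -(arrow_map_unique hU Uc bc hb)].
Qed.

(** The support of [Phi (ind R U)] is a bisection containing [gid y], so over a small [M] around [y]
    it consists of identities. Cutting [U] down accordingly gives a function with diagonal image,
    hence diagonal itself, and nonzero at [a]. *)
Lemma arrow_map_kernel a y : phi a = gid y -> range gid a.
Proof.
move=> ay.
have [U [hU Ua _]] := exists_homogeneous_bisection ampleX openT (I : setT a).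
have UA := indA hU.
have Oy : (gid @^-1` supp (Phi (ind R U))) y by rewrite /= -ay; exact: phi_supp.
have [M [coM My MU]] := boolean_space_nbhs ampleY.2
  (open_preimage (@gid_cts Y) (Phi_supp_open UA)) Oy.
have [K coK KM] := Phi_units_surj coM.
have [||_] := @diagonal_reflect (conv (ind R U) (unit_ind R K)).
- exact: groupoid_ring_conv_unit_indr.
- split; first by apply: Phi_in; exact: groupoid_ring_conv_unit_indr.
  move=> b /=; rewrite Phi_conv_unitr// KM => /mul_ind_neq0[hb Mb].
  exists (gdom b) => //; apply: (Phi_ind_bisection hU _ hb); first exact: MU.
  by rewrite gdom_id.
apply; rewrite /= conv_unit_indr !indT ?mulr1 1?eq_sym//.
by apply/(Phi_units_phi0 coK); rewrite -phi_dom ay gdom_id KM.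
Qed.

Lemma arrow_map_inv a : phi (ginv a) = ginv (phi a).
Proof.
apply: gid_eq; first by rewrite phi_dom gdom_inv arrow_map_rng.
rewrite -arrow_map_mul ?gdom_inv// gmulVl arrow_map_id.
by eexists.
Qed.

Lemma arrow_map_inj : injective phi.
Proof.
move=> a b ab.
have dab : gdom a = gdom b by apply: phi0_inj; rewrite -!phi_dom ab.
apply: gmulV_eq => //; apply: (@arrow_map_kernel _ (grng (phi b))).
by rewrite arrow_map_mul ?grng_inv// arrow_map_inv ab gmulVr.
Qed.

(** The preimage [f] of the indicator of a bisection around [b] may take values other than 0 and 1,
    so it is compared with [ind R U] on a bisection [U] where it is constant. *)
Lemma arrow_map_surj b : exists a, phi a = b.
Proof.
have [W [hW Wb _]] := exists_homogeneous_bisection ampleY openT (I : setT b).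
have WA : groupoid_ring R Y (ind R W).
  by apply: groupoid_ring_ind => //; exact: homogeneous_bisection_compact_open.
have [_ [t Wt]] := hW.
have [|f [fA ft fW]] := @Phi_homogeneous_surj _ t WA.
  by move=> c /ind_neq0/Wt.
have [|a [fa ba rba]] := @Phi_ends_preimage f b fA.
  by rewrite fW indT// eq_sym.
have fc := groupoid_ring_locally_constant fA.
have [U [hU Ua Uf]] := exists_homogeneous_bisection ampleX
  (locally_constant_preimage [set f a] fc) (erefl (f a)).
have coU := homogeneous_bisection_compact_open hU.
have codU := compact_open_gdom ampleX coU.
have corU := compact_open_grng ampleX coU.
(* [Phi] need not be [R]-linear: the scalar [f a] is absorbed into a diagonal element, whose image
   is again diagonal and so acts by pointwise multiplication. *)
pose e c := f a * unit_ind R (grng @` U) c.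
have eD : diagonal_subalgebra R X e.
  split; last by move=> c /=; rewrite /e => /mul_ind_neq0[_ [x _ <-]]; exists x.
  have -> : e = fun c => unit_ind R (grng @` U) c * (fun=> f a) c.
    by apply/funext => c; rewrite mulrC.
  apply: groupoid_ring_mul; first exact: unitA.
  by move=> c; exact: nearW.
(* [f] takes the constant value [f a] on [U], and its support is a bisection. *)
have feU : conv f (unit_ind R (gdom @` U)) = conv e (ind R U).
  apply/funext => c.
  rewrite conv_unit_indr (diagonal_conv _ _ eD) /e unit_ind_gid.
  have [Uc|nUc] := pselect (U c).
    by rewrite !indT ?mulr1 ?(Uf c Uc)//; exists c.
  rewrite (indF _ nUc) mulr0; apply/eqP; apply: contra_notT nUc.
  move=> /mul_ind_neq0[fc0 [d Ud dc]].
  suff -> : c = d by [].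
  apply: (Phi_preimage_bisection fA ft hW fW) => //.
  by rewrite (Uf d Ud).
have bU : Phi_units (gdom @` U) (gdom b).
  by rewrite ba; apply/(Phi_units_phi0 codU); exists a.
have : Phi (conv f (unit_ind R (gdom @` U))) b != 0.
  by rewrite Phi_conv_unitr// fW !indT// mulr1 eq_sym.
rewrite feU PhiM ?(diagonal_conv _ _ (Phi_diagonal eD)); last 2 first.
- by case: eD.
- exact: indA.
move=> eb; exists a; apply/esym/(arrow_map_unique hU Ua ba).
by apply: contra_neq eb => ->; rewrite mulr0.
Qed.

Lemma arrow_map_isomorphism :
  exists phi : cfunctor X Y, groupoid_isomorphism phi /\ graded_cfunctor phi.
Proof.
exists (CFunctor phi_dom arrow_map_rng arrow_map_id arrow_map_mul phi0_cts
  arrow_map_cts).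
split; last exact: arrow_map_cocycle.
apply: (@groupoid_isomorphism_open _ _ _ psi0) => //.
- exact: arrow_map_inj.
- exact: arrow_map_surj.
- exact: arrow_map_open.
Qed.

End ArrowMap.
End Arrows.

Lemma graded_isomorphism_of_ring :
  exists phi : cfunctor X Y, groupoid_isomorphism phi /\ graded_cfunctor phi.
Proof.
have [phi0 [psi0 [phi0K psi0K phi0_cts psi0_cts phi0P]]] :=
  stone_duality ampleX.2 ampleY.2 Phi_units_embedding Phi_units_surj.
have /choice[phi phiP] := arrow_image_exists phi0P.
exact: (arrow_map_isomorphism phi0K psi0K phi0_cts psi0_cts phi0P phiP).
Qed.

End Rigidity.

(** * From a graded groupoid isomorphism to an algebra isomorphism *)

Section Pullback.
Variables (R : comPzRingType) (X Y : topGroupoid).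
Variables (phi : cfunctor X Y) (psi : cfunctor Y X).
Hypotheses (phi0K : cancel (fobj phi) (fobj psi)).
Hypotheses (psi0K : cancel (fobj psi) (fobj phi)).
Hypotheses (phiK : cancel phi psi) (psiK : cancel psi phi).

Lemma groupoid_ring_pullback (f : garr X -> R) :
  groupoid_ring R X f -> groupoid_ring R Y (f \o psi).
Proof.
move=> /groupoid_ringP[fc fk]; apply/groupoid_ringP; split.
  exact: (locally_constant_comp (@farr_cts _ _ psi)).
rewrite (_ : supp _ = phi @` supp f).
  by apply: continuous_compact => //; exact/continuous_subspaceT/farr_cts.
apply/seteqP; split=> [b fb|_ [a fa <-]]; last by rewrite /supp/= phiK.
by exists (psi b).
Qed.

(** [psi] maps the arrows with the domain of [b] bijectively onto those with the domain of [psi b],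
    which reindexes the sum. *)
Lemma conv_pullback (f g : garr X -> R) :
  conv f g \o psi = conv (f \o psi) (g \o psi).
Proof.
apply/funext => b; rewrite /conv /=.
rewrite (@reindex_fsbig _ _ _ _ _ psi [set a | gdom a = gdom b]); last first.
  split=> [a /= ab|a c _ _|a /= ab]; first by rewrite !farr_dom ab.
    exact: (can_inj psiK).
  exists (phi a); last exact: phiK.
  by rewrite /= farr_dom ab farr_dom psi0K.
apply: eq_fsbigr => a /set_mem /= ab.
by rewrite -cfunctor_inv -farr_mul// grng_inv.
Qed.

End Pullback.

Section PullbackIsomorphism.
Variables (R : comPzRingType) (X Y : topGroupoid).
Variables (phi : cfunctor X Y) (psi : cfunctor Y X).
Hypotheses (phi0K : cancel (fobj phi) (fobj psi)).
Hypotheses (psi0K : cancel (fobj psi) (fobj phi)).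
Hypotheses (phiK : cancel phi psi) (psiK : cancel psi phi).

Lemma pullbackK (h : garr Y -> R) : (h \o phi) \o psi = h.
Proof. by apply/funext => b /=; rewrite psiK. Qed.

Lemma pullback_algebra_isomorphism :
  algebra_isomorphism (fun f : garr X -> R => f \o psi).
Proof.
split; last by [].
split=> //; last by move=> f g _ _; exact: conv_pullback.
split=> [f|f g _ _ fg|h hA]; first exact: groupoid_ring_pullback.
  by apply/funext => a; have := congr1 (fun h => h (phi a)) fg; rewrite /= phiK.
by exists (h \o phi); [exact: groupoid_ring_pullback|exact: pullbackK].
Qed.

(** Applied with fibers of the cocycles for the grading, and with identity arrows for the
    diagonal. *)
Lemma pullback_supported_on (A : set (garr X)) (B : set (garr Y)) :
  (forall a, A a <-> B (phi a)) ->
  (fun f : garr X -> R => f \o psi) @`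
    (groupoid_ring R X `&` supported_on A) =
  groupoid_ring R Y `&` supported_on B.
Proof.
move=> AB; apply/seteqP; split=> [_ [f [fA fs] <-]|h [hA hs]].
  split; first exact: groupoid_ring_pullback.
  by move=> b /fs/AB; rewrite psiK.
exists (h \o phi); last exact: pullbackK.
by split=> [|a /hs/AB//]; exact: groupoid_ring_pullback.
Qed.

End PullbackIsomorphism.

Lemma graded_isomorphism_algebra (G : groupType) (R : comPzRingType)
    (X Y : gradedGroupoid G) (phi : cfunctor X Y) :
  groupoid_isomorphism phi -> graded_cfunctor phi ->
  exists Phi : (garr X -> R) -> (garr Y -> R),
    [/\ algebra_isomorphism Phi, graded_map Phi & diagonal_preserving Phi].
Proof.
move=> [psi [phi0K psi0K phiK psiK]] phi_graded.
exists (fun f => f \o psi); split.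
- exact: (pullback_algebra_isomorphism _ psi0K phiK psiK).
- move=> t; apply: (pullback_supported_on _ phiK psiK) => a.
  by rewrite /fiber /= phi_graded.
- apply: (pullback_supported_on _ phiK psiK) => a.
  split=> [[x _ <-]|/range_gid pa]; first by rewrite farr_id; eexists.
  exists (gdom a) => //; apply: (can_inj phiK).
  by rewrite farr_id -farr_dom -pa.
Qed.

Theorem corollary5p8 (G : groupType) (R : comPzRingType)
    (X Y : gradedGroupoid G) :
  indecomposable R ->
  ample X -> hausdorff_groupoid X ->
  ample Y -> hausdorff_groupoid Y ->
  effective (fiber1_groupoid X) ->
  [<->
       exists phi : cfunctor X Y,
         groupoid_isomorphism phi /\ graded_cfunctor phi;
       exists Phi : (garr X -> R) -> (garr Y -> R),
         [/\ algebra_isomorphism Phi, graded_map Phi &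
             diagonal_preserving Phi];
       exists Phi : (garr X -> R) -> (garr Y -> R),
         [/\ ring_isomorphism Phi, graded_map Phi &
             diagonal_preserving Phi];
       exists Phi : (garr X -> R) -> (garr Y -> R),
         [/\ algebra_isomorphism Phi, graded_map Phi &
             Phi @` diagonal_subalgebra R X `<=` diagonal_subalgebra R Y];
       exists Phi : (garr X -> R) -> (garr Y -> R),
         [/\ ring_isomorphism Phi, graded_map Phi &
             Phi @` diagonal_subalgebra R X `<=` diagonal_subalgebra R Y]].
Proof.
move=> indR ampleX hX ampleY hY /effective_fiber1 effX; tfae.
- move=> [phi [phi_iso phi_graded]].
  exact: graded_isomorphism_algebra phi_graded.
- by move=> [Phi [[ringPhi _] gradPhi diagPhi]]; exists Phi.
- move=> [Phi [ringPhi gradPhi diagPhi]].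
  have diagS : Phi @` diagonal_subalgebra R X `<=` diagonal_subalgebra R Y.
    by rewrite diagPhi.
  (* The given ring isomorphism need not be [R]-linear; an algebra isomorphism is rebuilt from the
     groupoid isomorphism it induces. *)
  have [phi [phi_iso phi_graded]] := graded_isomorphism_of_ring
    indR ampleX hX ampleY hY effX ringPhi gradPhi diagS.
  have [Psi [algPsi gradPsi diagPsi]] :=
    graded_isomorphism_algebra R phi_iso phi_graded.
  by exists Psi; split=> //; rewrite diagPsi.
- by move=> [Phi [[ringPhi _] gradPhi diagPhi]]; exists Phi.
- move=> [Phi [ringPhi gradPhi diagPhi]].
  exact: graded_isomorphism_of_ring ringPhi gradPhi diagPhi.
Qed.
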